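(* Let $(f_h^n,\mathbf E_h^n)_{n\ge0}$ be produced by the fully discrete discontinuous Galerkin (DG) method for the Vlasov–Ampère system with time integrator $\textbf{Scheme-1}(\Delta t)$ (defined in the context), with either upwind or central numerical fluxes. Then the total particle number is preserved: $$\int_{\Omega_x}\int_{\Omega_v} f_h^{n+1}\,d\mathbf v\,d\mathbf x=\int_{\Omega_x}\int_{\Omega_v} f_h^{n}\,d\mathbf v\,d\mathbf x .$$ The same holds for the DG methods with time integrators $\textbf{Scheme-2}(\Delta t)$, $\textbf{Scheme-3}(\Delta t)$, $\textbf{Scheme-2F}(\Delta t)$ and $\textbf{Scheme-3F}(\Delta t)$.
   Context: The Vlasov–Ampère system is $\partial_t f+\mathbf v\cdot\nabla_{\mathbf x}f+\mathbf E\cdot\nabla_{\mathbf v}f=0$, $\partial_t\mathbf E=-\mathbf J$, $\mathbf J=\int_{\Omega_v}f\mathbf v\,d\mathbf v$, on $\Omega=\Omega_x\times\Omega_v$, where $\Omega_x,\Omega_v\subset\mathbb R^{d}$ are bounded, with periodic boundary conditions in $\mathbf x$. Mesh and space. $\mathcal T_h^x=\{K_x\}$, $\mathcal T_h^v=\{K_v\}$ are partitions of $\Omega_x$, $\Omega_v$ into Cartesian elements or simplices, and $\mathcal T_h=\{K=K_x\times K_v\}$. For an integer $k\ge0$, $$\mathcal G_h^k=\{g\in L^2(\Omega): g|_{K_x\times K_v}\in P^k(K_x\times K_v)\ \ \forall K_x\in\mathcal T_h^x,\,K_v\in\mathcal T_h^v\},$$ with $P^k(D)$ the polynomials of total degree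 at most $k$ on $D$. On an edge shared by $K_x^+,K_x^-$ with outward unit normals $\mathbf n_x^\pm$ (respectively $K_v^\pm$, $\mathbf n_v^\pm$), with traces $g^\pm$, set $[g]=g^+\mathbf n^++g^-\mathbf n^-$ and $\{g\}=\frac12(g^++g^-)$ (similarly $\{\mathbf U\}=\frac12(\mathbf U^++\mathbf U^-)$), with subscript $x$ or $v$ indicating the variable. Edges in $\mathbf x$ are identified periodically. Numerical fluxes. Upwind: $\widehat{f\mathbf v\cdot\mathbf n_x}=\big(\{f\mathbf v\}_x+\frac{|\mathbf v\cdot\mathbf n_x|}2[f]_x\big)\cdot\mathbf n_x$, $\widehat{f\mathbf E\cdot\mathbf n_v}=\big(\{f\mathbf E\}_v+\frac{|\mathbf E\cdot\mathbf n_v|}2[f]_v\big)\cdot\mathbf n_v$. Central: the same without the jump terms. For steps of negative length the upwind flux is replaced by the downwind flux (sign of the jump terms reversed). Standing assumption: $\Omega_v$ is so large that all numerical approximations of $f$ vanish at $\partial\Omega_v$ (traces are zero there, exterior value zero), so all numerical fluxes on $\partial\Omega_v$ vanish. For $K=K_x\times K_v$ put $$B_K(f,\mathbf E;g)=-\int_K f\mathbf v\cdot\nabla_{\mathbf x}g\,d\mathbf x d\mathbf v-\int_K f\mathbf E\cdot\nabla_{\mathbf v}g\,d\mathbf x d\mathbf v+\int_{K_v}\int_{\partial K_x}\widehat{f\mathbf v\cdot\mathbf n_x}\,g\,ds_xd\mathbf v+\int_{K_x}\int_{\partial K_v}\widehat{f\mathbf E\cdot\mathbf n_v}\,g\,ds_vd\mathbf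 x ,$$ where $\mathbf n_x,\mathbf n_v$ are outward unit normals of $\partial K_x,\partial K_v$, and $\mathbf J_h^m=\int_{\Omega_v}f_h^m\mathbf v\,d\mathbf v$. An initial field $\mathbf E_h^0(\mathbf x)$ and $f_h^0\in\mathcal G_h^k$ are given. In each scheme below all $f_h$'s lie in $\mathcal G_h^k$ and the equations hold for every $K$ and every $g\in\mathcal G_h^k$; for implicit schemes, any sequence satisfying the equations is meant. $\textbf{Scheme-1}(\Delta t)$: $\int_K\frac{f_h^{n+1/2}-f_h^n}{\Delta t/2}g+B_K(f_h^n,\mathbf E_h^n;g)=0$; $\ \frac{\mathbf E_h^{n+1}-\mathbf E_h^n}{\Delta t}=-\mathbf J_h^{n+1/2}$; $\ \int_K\frac{f_h^{n+1}-f_h^n}{\Delta t}g+B_K\big(f_h^{n+1/2},\tfrac12(\mathbf E_h^n+\mathbf E_h^{n+1});g\big)=0$. $\textbf{Scheme-2}(\Delta t)$: $\int_K\frac{f_h^{n+1}-f_h^n}{\Delta t}g+B_K\big(\tfrac12(f_h^n+f_h^{n+1}),\tfrac12(\mathbf E_h^n+\mathbf E_h^{n+1});g\big)=0$; $\ \frac{\mathbf E_h^{n+1}-\mathbf E_h^n}{\Delta t}=-\tfrac12(\mathbf J_h^n+\mathbf J_h^{n+1})$. $\textbf{Scheme-3}(\Delta t)$: $\frac{\mathbf E_h^{n+1/2}-\mathbf E_h^n}{\Delta t/2}=-\mathbf J_h^n$; $\ \int_K\frac{f_h^{n+1}-f_h^n}{\Delta t}g+B_K\big(\tfrac12(f_h^n+f_h^{n+1}),\mathbf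 E_h^{n+1/2};g\big)=0$; $\ \frac{\mathbf E_h^{n+1}-\mathbf E_h^{n+1/2}}{\Delta t/2}=-\mathbf J_h^{n+1}$. For $X\in\{2,3\}$, $\textbf{Scheme-}X\textbf{F}(\Delta t)=\textbf{Scheme-}X(\beta_1\Delta t)\,\textbf{Scheme-}X(\beta_2\Delta t)\,\textbf{Scheme-}X(\beta_3\Delta t)$ (composition), with $\beta_1=\beta_3=(2+2^{1/3}+2^{-1/3})/3$, $\beta_2=1-2\beta_1<0$. *)

(* Defs.v *)
From HB Require Import structures.
From mathcomp Require Import all_boot all_order all_algebra.
From mathcomp Require mpoly.
(* The notations of mpoly and of all_analysis are incompatible. *)
Import -(notations) mpoly.
From mathcomp Require Import all_classical all_reals all_analysis.

Set Implicit Arguments.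
Unset Strict Implicit.
Unset Printing Implicit Defensive.

Import Order.TTheory GRing.Theory Num.Theory.
Import numFieldNormedType.Exports.

Local Open Scope classical_set_scope.
Local Open Scope ring_scope.

Definition rV_display : measure_display. Proof. by []. Qed.

(* The sigma-algebra on R^n is generated by the coordinates. *)
Section measurable_rV.
Context {R : realType} {n : nat}.

Let coor (i : 'I_n) (x : 'rV[R]_n) : measurableTypeR R := x ord0 i.

Let rV_set0 : g_sigma_preimage coor set0.
Proof. exact: sigma_algebra0. Qed.

Let rV_setC A : g_sigma_preimage coor A -> g_sigma_preimage coor (~` A).
Proof. exact: sigma_algebraC. Qed.

Let rV_bigcup (F : _^nat) : (forall i, g_sigma_preimage coor (F i)) ->
  g_sigma_preimage coor (\bigcup_i (F i)).
Proof. exact: sigma_algebra_bigcup. Qed.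

HB.instance Definition _ := @isMeasurable.Build rV_display
  'rV[R]_n (g_sigma_preimage coor) rV_set0 rV_setC rV_bigcup.

Lemma measurable_fun_rVP d (T : measurableType d) (f : T -> 'rV[R]_n) :
  measurable_fun [set: T] f <->
  forall i, measurable_fun [set: T] (fun t => f t ord0 i : measurableTypeR R).
Proof.
apply: (@iff_trans _
    (g_sigma_preimage (fun i => coor i \o f) `<=` measurable)).
  rewrite g_sigma_preimage_comp; split=> [mf A [/= C preC <-]|prefS].
    exact: mf.
  by move=> _ A mA; apply: prefS; exists A.
split=> [cfS i|mf].
  move=> _ A mA; apply: cfS; apply: sub_sigma_algebra.
  rewrite -bigcup_seq/=; exists i; first by rewrite /= mem_index_enum.
  by exists A.
apply: smallest_sub; first exact: sigma_algebra_measurable.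
rewrite -bigcup_seq/=; apply: bigcup_sub => i _ B [A mA <-].
exact: mf.
Qed.

End measurable_rV.


Section lebesgue_rV.
Context {R : realType}.

Definition cons_rV n (p : measurableTypeR R * 'rV[R]_n) : 'rV[R]_n.+1 :=
  row_mx (p.1 : R)%:M p.2.

Definition uncons_rV n (x : 'rV[R]_n.+1) : measurableTypeR R * 'rV[R]_n :=
  (x ord0 ord0, \row_i x ord0 (lift ord0 i)).

Lemma cons_rVK n : cancel (@cons_rV n) (@uncons_rV n).
Proof.
case=> a x; rewrite /uncons_rV /cons_rV; congr pair => /=.
  have -> : ord0 = lshift n ord0 :> 'I_(1 + n) by exact/val_inj.
  by apply: etrans (row_mxEl _ _ _ _) _; rewrite mxE eqxx mulr1n.
apply/rowP => i; rewrite mxE /=.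
have -> : lift ord0 i = rshift 1 i :> 'I_(1 + n) by exact/val_inj.
exact: row_mxEr.
Qed.

Lemma measurable_coor n (i : 'I_n) :
  measurable_fun [set: 'rV[R]_n] (fun x => x ord0 i : measurableTypeR R).
Proof.
exact: ((measurable_fun_rVP (@idfun 'rV[R]_n)).1 (@measurable_id _ _ _) i).
Qed.

Lemma measurable_cons_rV n : measurable_fun [set: _] (@cons_rV n).
Proof.
apply/measurable_fun_rVP => i.
have [j ->|j ->] := split_ordP (i : 'I_(1 + n)).
  apply: (eq_measurable_fun fst) => [p _|]; last exact: measurable_fst.
  apply/esym; apply: etrans (row_mxEl _ _ _ _) _.
  by rewrite mxE !ord1 eqxx mulr1n.
apply: (eq_measurable_fun (fun p : measurableTypeR R * 'rV[R]_n =>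
  p.2 ord0 j : measurableTypeR R)) => [p _|].
  by apply/esym; exact: row_mxEr.
by apply: (measurableT_comp (measurable_coor j)); exact: measurable_snd.
Qed.

Lemma measurable_uncons_rV n : measurable_fun [set: _] (@uncons_rV n).
Proof.
apply: measurable_fun_pair; first exact: measurable_coor.
apply/measurable_fun_rVP => i.
apply: (eq_measurable_fun
  (fun x : 'rV[R]_n.+1 => x ord0 (lift ord0 i) : measurableTypeR R)) => [x _|].
  by rewrite mxE.
exact: measurable_coor.
Qed.

Section step.
Context {n : nat} (mu : {sigma_finite_measure set 'rV[R]_n -> \bar R}).

Definition leb_step : set 'rV[R]_n.+1 -> \bar R :=
  pushforward (@lebesgue_measure R \x mu)%E (@cons_rV n).

HB.instance Definition _ := Measure.copy leb_step
  (measure_function_pushforward__canonical__measure_function_Measure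
    (@lebesgue_measure R \x mu)%E (@measurable_cons_rV n)).

Lemma leb_step_sigma_finite : sigma_finite setT leb_step.
Proof.
have /sigma_finiteP[F [TF ndF Foo]] := sigma_finiteT (@lebesgue_measure R).
have /sigma_finiteP[G [TG ndG Goo]] := sigma_finiteT mu.
exists (fun k => @uncons_rV n @^-1` (F k `*` G k)) => [|k].
  apply/esym; rewrite -subTset => x _.
  have [i _ Fi] : (\bigcup_k F k) (uncons_rV x).1 by rewrite -TF.
  have [j _ Gj] : (\bigcup_k G k) (uncons_rV x).2 by rewrite -TG.
  exists (maxn i j) => //; split.
    by move: Fi; exact/subsetPset/ndF/leq_maxl.
  by move: Gj; exact/subsetPset/ndG/leq_maxr.
have [mF Fk] := Foo k; have [mG Gk] := Goo k; split.
  rewrite -[X in measurable X]setTI; apply: measurable_uncons_rV => //.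
  exact: measurableX.
rewrite /leb_step /pushforward -comp_preimage (_ : _ \o _ = id); last first.
  by apply/funext => p /=; rewrite cons_rVK.
by rewrite preimage_id product_measure1E// lte_mul_pinfty// ge0_fin_numE.
Qed.

HB.instance Definition _ := Measure_isSigmaFinite.Build _ _ R leb_step
  leb_step_sigma_finite.

End step.

(* The Lebesgue measure on R^n as an iterated product measure. *)
Fixpoint leb (n : nat) : {sigma_finite_measure set 'rV[R]_n -> \bar R} :=
  if n is m.+1 then leb_step (leb m) else dirac (0 : 'rV[R]_0).

End lebesgue_rV.

Section geometry.
Context {R : realType} {d : nat}.
Implicit Types (x n : 'rV[R]_d) (F : 'rV[R]_d * R).

Definition dot (x y : 'rV[R]_d) : R := \sum_i x ord0 i * y ord0 i.

Inductive element :=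
  | Cartesian of 'rV[R]_d & 'rV[R]_d
  | Simplex of 'M[R]_(d.+1, d).

(* The vertices p_0, ..., p_d of a simplex are the rows of P; the matrix with
   rows (1, p_j) sends barycentric coordinates w to (1, x), where x is the point
   w *m P. It is invertible iff the vertices are affinely independent. *)
Definition simplex_mx (P : 'M[R]_(d.+1, d)) : 'M[R]_(1 + d) :=
  row_mx (const_mx 1 : 'cV[R]_(1 + d)) P.

Definition nondegenerate (K : element) : Prop :=
  match K with
  | Cartesian a b => forall i, a ord0 i < b ord0 i
  | Simplex P => simplex_mx P \in unitmx
  end.

Definition cell (K : element) : set 'rV[R]_d :=
  match K with
  | Cartesian a b => [set x | forall i, a ord0 i <= x ord0 i <= b ord0 i]
  | Simplex P => [set x | exists w : 'rV[R]_d.+1,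
      [/\ forall j, 0 <= w ord0 j, \sum_j w ord0 j = 1 & x = w *m P]]
  end.

(* The j-th barycentric coordinate of x is alpha + dot g x, where (alpha, g) is
   the j-th column of the inverse of simplex_mx P. The facet opposite to the
   j-th vertex is its zero set, and the outward normal there is - g. *)
Definition simplex_facet (P : 'M[R]_(d.+1, d)) (j : 'I_(1 + d)) : 'rV[R]_d * R :=
  let A := invmx (simplex_mx P) in
  let g := \row_l A (rshift 1 l) j in
  let r := Num.sqrt (dot g g) in
  (- (r^-1 *: g), r^-1 * A (lshift d ord0) j).

(* A facet is given by its outward unit normal F.1 and the offset F.2 of the
   hyperplane dot F.1 x = F.2 that contains it. *)
Definition facets (K : element) : seq ('rV[R]_d * R) :=
  match K with
  | Cartesian a b =>
      [seq (- delta_mx ord0 i, - a ord0 i) | i <- enum 'I_d] ++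
      [seq (delta_mx ord0 i, b ord0 i) | i <- enum 'I_d]
  | Simplex P => [seq simplex_facet P j | j <- enum 'I_(1 + d)]
  end.

Definition facet (K : element) F : set 'rV[R]_d :=
  [set x | cell K x /\ dot F.1 x = F.2].

(* The integral of h ds over a subset A of the hyperplane of F. For a unit
   normal, Fubini along F.1 shows that it equals the d-dimensional integral of
   h \o hyperplane_proj F over the prism of height 1 with mid-section A. *)
Definition hyperplane_proj F x : 'rV[R]_d := x - (dot F.1 x - F.2) *: F.1.

Definition surface_integral F (A : set 'rV[R]_d) (h : 'rV[R]_d -> R) : R :=
  \int[leb d]_(x in [set x | `|dot F.1 x - F.2| <= 2^-1 /\
                             A (hyperplane_proj F x)]) h (hyperplane_proj F x).

(* Cells and domains are closed sets. Hanging nodes are allowed, and so are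
   Cartesian elements and simplices in one mesh. *)
Definition is_partition N (T : 'I_N -> element) (Omega : set 'rV[R]_d) : Prop :=
  [/\ forall i, nondegenerate (T i),
      Omega = \bigcup_(i in [set: 'I_N]) cell (T i) &
      forall i j, i != j -> (cell (T i))° `&` (cell (T j))° = set0].

Definition frontier (A : set 'rV[R]_d) : set 'rV[R]_d := closure A `\` A°.

(* The period lattice is generated by the rows of per. *)
Definition period (per : 'M[R]_d) (z : 'rV[int]_d) : 'rV[R]_d :=
  map_mx intr z *m per.

Definition translate (s : 'rV[R]_d) (A : set 'rV[R]_d) : set 'rV[R]_d :=
  [set x | A (x - s)].

Definition is_period_cell (per : 'M[R]_d) (Omega : set 'rV[R]_d) : Prop :=
  [/\ per \in unitmx,
      \bigcup_(z in [set: 'rV[int]_d]) translate (period per z) Omega = setT &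
      forall z, z != 0 -> Omega° `&` translate (period per z) Omega° = set0].

End geometry.

Arguments element : clear implicits.

Record phase_mesh (R : realType) (d : nat) := PhaseMesh {
  Omega_x : set 'rV[R]_d;
  Omega_v : set 'rV[R]_d;
  num_x : nat;
  num_v : nat;
  mesh_x : 'I_num_x -> element R d;
  mesh_v : 'I_num_v -> element R d;
  periods : 'M[R]_d;
  mesh_x_partition : is_partition mesh_x Omega_x;
  mesh_v_partition : is_partition mesh_v Omega_v;
  Omega_x_periodic : is_period_cell periods Omega_x }.

Arguments mesh_x {R d} p.
Arguments mesh_v {R d} p.

Inductive flux := Upwind | Central.

Inductive scheme := Scheme1 | Scheme2 | Scheme3 | Scheme2F | Scheme3F.

Section DG.
Context {R : realType} {d : nat} (M : phase_mesh R d).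

Local Notation Kx i := (cell (mesh_x M i)).
Local Notation Kv j := (cell (mesh_v M j)).

Definition ev (g : mpoly (d + d) R) (x v : 'rV[R]_d) : R :=
  meval (fun l => row_mx x v ord0 l) g.

(* A piecewise polynomial is the family of its restrictions to the elements
   Kx i `*` Kv j, as polynomials in the 2d coordinates (x, v); the traces on the
   boundary of an element are the values of its restriction. *)
Definition dgfun := 'I_(num_x M) -> 'I_(num_v M) -> mpoly (d + d) R.

Definition field := 'rV[R]_d -> 'rV[R]_d.

(* [mmeasure mdeg p] is 1 + the total degree of p, or 0 if p = 0. *)
Definition in_Gh (k : nat) (g : dgfun) : Prop :=
  forall i j, (mmeasure mdeg (g i j) <= k.+1)%N.

(* The L^2 function defined by the family; it is 0 on the skeleton. *)
Definition dgval (f : dgfun) (x v : 'rV[R]_d) : R :=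
  \sum_i \sum_j \1_((Kx i)° `*` (Kv j)°) (x, v) * ev (f i j) x v.

Definition grad_x (g : mpoly (d + d) R) (x v : 'rV[R]_d) : 'rV[R]_d :=
  \row_l ev (mderiv (lshift d l) g) x v.

Definition grad_v (g : mpoly (d + d) R) (x v : 'rV[R]_d) : 'rV[R]_d :=
  \row_l ev (mderiv (rshift d l) g) x v.

Definition current (f : dgfun) : field := fun x =>
  \row_l \int[leb d]_(v in Omega_v M) (dgval f x v * v ord0 l).

Definition average (a b : dgfun) : dgfun := fun i j => 2^-1 *: (a i j + b i j).

Definition average_field (E E' : field) : field :=
  fun x => 2^-1 *: (E x + E' x).

(* The flux of f a through a face with normals n+ and n-, in the direction n+;
   s is the sign of the jump term: 1 upwind, 0 central, -1 downwind. *)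
Definition numerical_flux (s : R) (a np nm : 'rV[R]_d) (fp fm : R) : R :=
  dot (2^-1 *: (fp *: a + fm *: a) +
       (s * `|dot a np| / 2) *: (fp *: np + fm *: nm)) np.

(* The boundary of Kx i is decomposed into the faces that it shares, modulo the
   periods, with elements on the other side of the same hyperplane. *)
Definition boundary_x (s : R) (f g : dgfun) i j (v : 'rV[R]_d) : R :=
  \sum_(F <- facets (mesh_x M i))
  \sum_i' \sum_(F' <- facets (mesh_x M i') | F'.1 == - F.1)
  \sum_(z \in [set: 'rV[int]_d])
    let p := period (periods M) z in
    surface_integral F
      (facet (mesh_x M i) F `&` translate p (facet (mesh_x M i') F'))
      (fun x => numerical_flux s v F.1 F'.1
                  (ev (f i j) x v) (ev (f i' j) (x - p) v) * ev (g i j) x v).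

(* Likewise for Kv j, whose boundary may also contain a part of the boundary of
   Omega_v, where the exterior value is 0. *)
Definition boundary_v (s : R) (f : dgfun) (E : field) (g : dgfun) i j
    (x : 'rV[R]_d) : R :=
  \sum_(F <- facets (mesh_v M j))
    (\sum_j' \sum_(F' <- facets (mesh_v M j') | F'.1 == - F.1)
      surface_integral F (facet (mesh_v M j) F `&` facet (mesh_v M j') F')
        (fun v => numerical_flux s (E x) F.1 F'.1
                    (ev (f i j) x v) (ev (f i j') x v) * ev (g i j) x v)
     + surface_integral F (facet (mesh_v M j) F `&` frontier (Omega_v M))
        (fun v => numerical_flux s (E x) F.1 (- F.1)
                    (ev (f i j) x v) 0 * ev (g i j) x v)).

Definition B (s : R) (f : dgfun) (E : field) (g : dgfun) i j : R :=
  - (\int[(leb d \x leb d)%E]_(z in Kx i `*` Kv j)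
       (ev (f i j) z.1 z.2 * dot z.2 (grad_x (g i j) z.1 z.2)))
  - (\int[(leb d \x leb d)%E]_(z in Kx i `*` Kv j)
       (ev (f i j) z.1 z.2 * dot (E z.1) (grad_v (g i j) z.1 z.2)))
  + \int[leb d]_(v in Kv j) boundary_x s f g i j v
  + \int[leb d]_(x in Kx i) boundary_v s f E g i j x.

Definition jump_sign (phi : flux) (tau : R) : R :=
  match phi with
  | Central => 0
  | Upwind => if tau < 0 then -1 else 1
  end.

Definition vanishes_on_frontier (f : dgfun) : Prop :=
  forall i j x v, Kx i x -> Kv j v -> frontier (Omega_v M) v ->
    ev (f i j) x v = 0.

Definition approximation (k : nat) (f : dgfun) : Prop :=
  in_Gh k f /\ vanishes_on_frontier f.

(* (f' - f) / tau + B(fm, E) = 0 *)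
Definition vlasov_eq (k : nat) (phi : flux) (tau : R) (f f' fm : dgfun)
    (E : field) : Prop :=
  forall (g : dgfun) i j, in_Gh k g ->
    \int[(leb d \x leb d)%E]_(z in Kx i `*` Kv j)
      ((ev (f' i j) z.1 z.2 - ev (f i j) z.1 z.2) / tau * ev (g i j) z.1 z.2)
    + B (jump_sign phi tau) fm E g i j = 0.

(* (E' - E) / tau = - J *)
Definition ampere_eq (tau : R) (E E' J : field) : Prop :=
  forall x, Omega_x M x -> tau^-1 *: (E' x - E x) = - J x.

Section steps.
Context (k : nat) (phi : flux).

Definition step := R -> dgfun * field -> dgfun * field -> Prop.

Definition step1 : step := fun dt st st' =>
  let: (f, E) := st in let: (f', E') := st' in
  exists fh : dgfun,
  [/\ [/\ approximation k f, approximation k fh & approximation k f'],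
      vlasov_eq k phi (dt / 2) f fh f E,
      ampere_eq dt E E' (current fh) &
      vlasov_eq k phi dt f f' fh (average_field E E')].

Definition step2 : step := fun dt st st' =>
  let: (f, E) := st in let: (f', E') := st' in
  [/\ approximation k f /\ approximation k f',
      vlasov_eq k phi dt f f' (average f f') (average_field E E') &
      ampere_eq dt E E' (average_field (current f) (current f'))].

Definition step3 : step := fun dt st st' =>
  let: (f, E) := st in let: (f', E') := st' in
  exists Eh : field,
  [/\ approximation k f /\ approximation k f',
      ampere_eq (dt / 2) E Eh (current f),
      vlasov_eq k phi dt f f' (average f f') Eh &
      ampere_eq (dt / 2) Eh E' (current f')].

Definition beta1 : R := (2 + 2 `^ (3^-1) + 2 `^ (- 3^-1)) / 3.
Definition beta2 : R := 1 - 2 * beta1.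
Definition beta3 : R := beta1.

(* In a composition of operators the rightmost factor acts first. *)
Definition fourth_order (S : step) : step := fun dt st st' =>
  exists st1 st2,
  [/\ S (beta3 * dt) st st1, S (beta2 * dt) st1 st2 & S (beta1 * dt) st2 st'].

Definition scheme_step (X : scheme) : step :=
  match X with
  | Scheme1 => step1
  | Scheme2 => step2
  | Scheme3 => step3
  | Scheme2F => fourth_order step2
  | Scheme3F => fourth_order step3
  end.

End steps.

(* This makes the integrals of the schemes well defined. *)
Definition integrable_field (E : field) : Prop :=
  forall l, (leb d).-integrable (Omega_x M) (fun x => (E x ord0 l)%:E).

Definition particle_number (f : dgfun) : R :=
  \int[leb d]_(x in Omega_x M) \int[leb d]_(v in Omega_v M) dgval f x v.

End DG.

(* Main.v *)
Require Import Defs.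
From mathcomp Require Import all_boot all_order all_algebra.
From mathcomp Require mpoly.
Import -(notations) mpoly.
From mathcomp Require Import all_classical all_reals all_analysis.
From mathcomp Require Import measurable_realfun ring lra.

Set Implicit Arguments.
Unset Strict Implicit.
Unset Printing Implicit Defensive.

Import Order.TTheory GRing.Theory Num.Theory.
Import numFieldNormedType.Exports.

Local Open Scope classical_set_scope.
Local Open Scope ring_scope.

(* Testing the Vlasov equation with g = 1 leaves only the numerical fluxes. A
   face term is the flux through the intersection of a facet F of one element
   with a (translated) facet F' of an element on the other side, and the same
   flux with the opposite sign is counted for F'; the flux through the boundary
   of Omega_v is 0 since the trace of f vanishes there. Summing over all
   elements, everything cancels. The cancellation needs the translation
   invariance of the measure (for the periodic identification in x), and the
   summation under the integrals needs integrability: cells are bounded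
   polytopes, so polynomials are bounded on them, and the field stays integrable
   because each step changes it by a bounded current. *)

(** * Bounded measurable functions and Fubini's theorem *)

(** Real integrals are total functions here: they have a value even for a non-integrable integrand,
    and a sum over an infinite support defaults to 0. Every exchange of a sum with an integral
    therefore has to be justified, and this shapes the proof. The traces of the discrete functions
    are bounded, but the field is only integrable. So the flux is split by [numerical_fluxE] into
    $a\cdot n$ times a mean of traces plus $|a\cdot n|$ times a difference of traces, and
    integrability reduces to a bounded function times an integrable scalar. The same splitting gives
    the antisymmetry for every real jump coefficient [s], which covers upwind, central and downwind
    fluxes at once, hence also steps of negative length. A second gap lies between
    [particle_number], whose integrand is 0 on the skeleton, and the scheme, which integrates over
    closed cells. It is bridged by writing a cell as a finite intersection of half-spaces with
    nonzero normals, so that its boundary is a null set; the positivity of [d] enters there. *)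

Section bounded_measurable.
Context {R : realType} {d : measure_display} {T : measurableType d}.
Implicit Types (D : set T) (f g : T -> R).

(** Unlike integrability, this property is stable under products, and it gives integrability on any
    measurable set of finite measure. Domains, cells and prisms over faces are all of this kind. *)
Definition bmfun D f := measurable_fun D f /\ exists C, forall x, D x -> `|f x| <= C.

Lemma bmfun_cst D r : bmfun D (fun=> r).
Proof. by split; [exact: measurable_cst | exists `|r|]. Qed.

Lemma bmfunD D f g : bmfun D f -> bmfun D g -> bmfun D (fun x => f x + g x).
Proof.
move=> [mf [A fA]] [mg [C gC]]; split; first exact: measurable_funD.
by exists (A + C) => x Dx; rewrite (le_trans (ler_normD _ _))// lerD ?fA ?gC.
Qed.

Lemma bmfunM D f g : bmfun D f -> bmfun D g -> bmfun D (fun x => f x * g x).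
Proof.
move=> [mf [A fA]] [mg [C gC]]; split; first exact: measurable_funM.
by exists (A * C) => x Dx; rewrite normrM ler_pM ?fA ?gC.
Qed.

Lemma bmfunX D f n : bmfun D f -> bmfun D (fun x => f x ^+ n).
Proof.
move=> bf; elim: n => [|n IH]; first exact: bmfun_cst.
by under eq_fun do rewrite exprS; exact: bmfunM.
Qed.

Lemma bmfun_sum D (I : Type) (s : seq I) (P : pred I) (F : I -> T -> R) :
  (forall i, P i -> bmfun D (F i)) -> bmfun D (fun x => \sum_(i <- s | P i) F i x).
Proof.
move=> bF; elim: s => [|i s IH].
  by under eq_fun do rewrite big_nil; exact: bmfun_cst.
case Pi: (P i); last by under eq_fun do rewrite big_cons Pi.
by under eq_fun do rewrite big_cons Pi; apply: bmfunD => //; exact: bF.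
Qed.

Lemma bmfun_prod D (I : Type) (s : seq I) (P : pred I) (F : I -> T -> R) :
  (forall i, P i -> bmfun D (F i)) -> bmfun D (fun x => \prod_(i <- s | P i) F i x).
Proof.
move=> bF; elim: s => [|i s IH].
  by under eq_fun do rewrite big_nil; exact: bmfun_cst.
case Pi: (P i); last by under eq_fun do rewrite big_cons Pi.
by under eq_fun do rewrite big_cons Pi; apply: bmfunM => //; exact: bF.
Qed.

Lemma bmfun_indic D A : measurable A -> bmfun D (\1_A : T -> R).
Proof.
move=> mA; split; first exact/measurable_funTS/measurable_indic.
by exists 1 => x _; rewrite indicE; case: (_ \in _); rewrite ?normr0 ?normr1.
Qed.

Lemma eq_bmfun D f g : (forall x, D x -> f x = g x) -> bmfun D f -> bmfun D g.
Proof.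
move=> fg [mf [C fC]]; split.
  by apply: eq_measurable_fun mf => x; rewrite inE; exact: fg.
by exists C => x Dx; rewrite -fg// fC.
Qed.

Lemma bmfun_meval D n (p : mpoly n R) (a : 'I_n -> T -> R) :
  (forall i, bmfun D (a i)) -> bmfun D (fun x => meval (fun i => a i x) p).
Proof.
move=> ba; under eq_fun do rewrite mevalE.
apply: bmfun_sum => m _; apply: bmfunM; first exact: bmfun_cst.
by apply: bmfun_prod => i _; exact: bmfunX.
Qed.

Lemma bmfun_bounded D f : bmfun D f -> [bounded f x | x in D].
Proof.
move=> [_ [C fC]]; exists C; split; first exact: num_real.
by move=> K CK x Dx; exact: le_trans (fC x Dx) (ltW CK).
Qed.

Lemma bmfun_integrable (mu : {measure set T -> \bar R}) D f :
  measurable D -> (mu D < +oo)%E -> bmfun D f -> mu.-integrable D (EFin \o f).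
Proof.
move=> mD Doo bf; apply: measurable_bounded_integrable => //; first exact: bf.1.
exact: bmfun_bounded.
Qed.

Lemma integrable_bmfunM (mu : {measure set T -> \bar R}) D f g :
  measurable D -> bmfun D f -> mu.-integrable D (EFin \o g) ->
  mu.-integrable D (EFin \o (fun x => f x * g x)).
Proof.
move=> mD bf ig.
have -> : EFin \o (fun x => f x * g x) = ((EFin \o f) \* (EFin \o g))%E.
  by apply/funext => x /=; rewrite EFinM.
by apply: integrableMr => //; [exact: bf.1 | exact: bmfun_bounded].
Qed.

Lemma integrable_sumR (mu : {measure set T -> \bar R}) D (I : Type) (s : seq I)
    (P : pred I) (F : I -> T -> R) : measurable D ->
  (forall i, P i -> mu.-integrable D (EFin \o F i)) ->
  mu.-integrable D (EFin \o (fun x => \sum_(i <- s | P i) F i x)).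
Proof.
move=> mD iF; elim: s => [|i s IH].
  have -> : EFin \o (fun x => \sum_(i <- [::] | P i) F i x) = cst 0%E.
    by apply/funext => x /=; rewrite big_nil.
  exact: integrable0.
have -> : EFin \o (fun x => \sum_(i <- i :: s | P i) F i x) =
    if P i then ((EFin \o F i) \+ (EFin \o (fun x => (\sum_(i <- s | P i) F i x)%R)))%E
    else EFin \o (fun x => \sum_(i <- s | P i) F i x).
  by apply/funext => x /=; case: ifPn => Pi /=; rewrite big_cons ?Pi ?(negbTE Pi).
case: ifPn => // /iF iFi; exact: integrableD.
Qed.

Lemma Rintegral_sum (mu : {measure set T -> \bar R}) D (I : Type) (s : seq I)
    (P : pred I) (F : I -> T -> R) : measurable D ->
  (forall i, P i -> mu.-integrable D (EFin \o F i)) ->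
  \int[mu]_(x in D) (\sum_(i <- s | P i) F i x) =
  \sum_(i <- s | P i) \int[mu]_(x in D) F i x.
Proof.
move=> mD iF; elim: s => [|i s IH].
  by rewrite big_nil; under eq_Rintegral do rewrite big_nil; rewrite Rintegral_cst ?mul0r.
rewrite big_cons; under eq_Rintegral do rewrite big_cons.
case: ifPn => // Pi; rewrite RintegralD ?IH//; first exact: iF.
exact: integrable_sumR.
Qed.

End bounded_measurable.

Section fubini.
Context {R : realType} {d1 d2 : measure_display}.
Context {T1 : measurableType d1} {T2 : measurableType d2}.
Variables (m1 : {sigma_finite_measure set T1 -> \bar R}).
Variables (m2 : {sigma_finite_measure set T2 -> \bar R}).
Implicit Types (A : set T1) (C : set T2) (h : T1 * T2 -> R).

Lemma bmfun_fst A C (f : T1 -> R) : measurable A -> measurable C ->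
  bmfun A f -> bmfun (A `*` C) (fun z => f z.1).
Proof.
move=> mA mC [mf [K fK]]; split; last by exists K => z [/fK].
apply: (measurable_comp mA _ mf) => [_ [z [Az _] <-]//|].
exact: measurable_funTS measurable_fst.
Qed.

Lemma bmfun_snd A C (f : T2 -> R) : measurable A -> measurable C ->
  bmfun C f -> bmfun (A `*` C) (fun z => f z.2).
Proof.
move=> mA mC [mf [K fK]]; split; last by exists K => z [_ /fK].
apply: (measurable_comp mC _ mf) => [_ [z [_ Cz] <-]//|].
exact: measurable_funTS measurable_snd.
Qed.

Lemma bmfun_section A C h x : measurable A -> measurable C -> A x ->
  bmfun (A `*` C) h -> bmfun C (fun y => h (x, y)).
Proof.
move=> mA mC Ax [mh [K hK]]; split; last by exists K => y Cy; exact: hK.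
apply: (measurable_comp (measurableX mA mC) _ mh) => [_ [y Cy <-]//|].
exact/measurable_funTS/measurable_pair1.
Qed.

Section finite.
Variables (A : set T1) (C : set T2).
Hypotheses (mA : measurable A) (mC : measurable C).
Hypotheses (Afin : (m1 A < +oo)%E) (Cfin : (m2 C < +oo)%E).

Lemma product_finite : ((m1 \x m2)%E (A `*` C) < +oo)%E.
Proof. by rewrite product_measure1E// lte_mul_pinfty// ge0_fin_numE. Qed.

(** Extension by zero turns integrals over the rectangle into integrals over the whole product
    space, where Fubini's theorem is applied. *)
Let patch h := (EFin \o h) \_ (A `*` C).

Let patch_in h x : A x -> bmfun (A `*` C) h ->
  (\int[m2]_y patch h (x, y) = (\int[m2]_(y in C) h (x, y))%:E)%E.
Proof.
move=> Ax bh; transitivity (\int[m2]_(y in C) (h (x, y))%:E)%E.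
  rewrite [RHS]integral_mkcond; apply: eq_integral => y _.
  by rewrite /patch !patchE in_setX (mem_set Ax).
rewrite fineK//; apply: integrable_fin_num => //.
by apply: (bmfun_integrable mC Cfin); exact: bmfun_section bh.
Qed.

Let patch_out h x : ~ A x -> (\int[m2]_y patch h (x, y) = 0)%E.
Proof.
move=> Ax; apply: integral0_eq => y _.
by rewrite /patch patchE in_setX memNset.
Qed.

Let integrable_patch h : bmfun (A `*` C) h ->
  (m1 \x m2)%E.-integrable setT (patch h).
Proof.
move=> bh; apply/(integrable_mkcond _ _).1; first exact: measurableX.
by apply: bmfun_integrable => //; [exact: measurableX | exact: product_finite].
Qed.

(** Measurability comes from Fubini's theorem for the extension by zero, and a bound is that of [h]
    times the measure of [C]. This is what makes a surface integral depending on a parameter a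
    bounded factor. *)
Lemma bmfun_Rintegral h : bmfun (A `*` C) h ->
  bmfun A (fun x => \int[m2]_(y in C) h (x, y)).
Proof.
move=> bh; split.
  apply/measurable_EFinP.
  apply: (eq_measurable_fun (fubini_F m2 (patch h))).
    by move=> x; rewrite inE => Ax; rewrite /fubini_F patch_in.
  by apply: measurable_funTS; apply: measurable_fubini_F; exact: integrable_patch.
have [_ [K hK]] := bh.
exists (K * fine (m2 C)) => x Ax.
have bs := bmfun_section mA mC Ax bh.
apply: le_trans (le_normr_Rintegral mC (bmfun_integrable mC Cfin bs)) _.
rewrite -(Rintegral_cst m2 mC); apply: le_Rintegral => //.
- apply: (bmfun_integrable mC Cfin); have [ms _] := bs; split.
    exact: measurableT_comp.
  by exists K => y Cy; rewrite normr_id; exact: hK.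
- by apply: (bmfun_integrable mC Cfin); exact: bmfun_cst.
- by move=> y Cy; exact: hK.
Qed.

Lemma bmfun_Fubini h : bmfun (A `*` C) h ->
  \int[m1]_(x in A) \int[m2]_(y in C) h (x, y) =
  \int[(m1 \x m2)%E]_(z in A `*` C) h z.
Proof.
move=> bh; congr fine; rewrite [RHS]integral_mkcond [LHS]integral_mkcond.
rewrite -(integral12_prod_meas1 (integrable_patch bh)).
apply: eq_integral => x _; rewrite patchE.
case: ifPn; rewrite ?inE ?notin_setE => Ax.
  by rewrite -patch_in.
by rewrite /fubini_F patch_out.
Qed.

End finite.
End fubini.

(** * The Lebesgue measure on R^n *)

Section lebesgue_rV_theory.
Context {R : realType}.

Lemma cons_rV0 n (p : measurableTypeR R * 'rV[R]_n) :
  cons_rV p ord0 ord0 = p.1.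
Proof. exact: (congr1 fst (@cons_rVK R n p)). Qed.

Lemma cons_rVS n (p : measurableTypeR R * 'rV[R]_n) i :
  cons_rV p ord0 (lift ord0 i) = p.2 ord0 i.
Proof.
by have /(congr1 (fun q : measurableTypeR R * 'rV[R]_n => q.2 ord0 i)) :=
  @cons_rVK R n p; rewrite /= mxE.
Qed.

Lemma measurable_sublevel d (T : measurableType d) (f : T -> R) c :
  measurable_fun setT f -> measurable [set x | f x <= c].
Proof.
move=> mf; rewrite -[X in measurable X]setTI.
rewrite (_ : [set _ | _] = f @^-1` `]-oo, c]); first exact: mf.
by apply/seteqP; split=> x; rewrite /= in_itv.
Qed.

Lemma measurable_dot n (a : 'rV[R]_n) : measurable_fun [set: 'rV[R]_n] (dot a).
Proof.
apply: (@measurable_sum _ _ R setT _ _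
  (fun i (x : 'rV[R]_n) => a ord0 i * x ord0 i)) => i.
by apply: measurable_funM => //; exact: measurable_coor.
Qed.

Lemma measurable_shift_rV n (p : 'rV[R]_n) :
  measurable_fun [set: 'rV[R]_n] (fun x => x - p).
Proof.
apply/measurable_fun_rVP => i.
under eq_fun do rewrite !mxE.
by apply: measurable_funB => //; exact: measurable_coor.
Qed.

Lemma measurable_translate n (p : 'rV[R]_n) (A : set 'rV[R]_n) :
  measurable A -> measurable (translate p A).
Proof. by move=> mA; rewrite -[translate _ _]setTI; exact: measurable_shift_rV. Qed.

(** The image of Lebesgue measure under the shift gives each half-open interval its length, and this
    determines the measure. *)
Lemma lebesgue_measure_translate (p : R) (A : set (measurableTypeR R)) : measurable A ->
  lebesgue_measure [set x | A (x - p)] = lebesgue_measure A.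
Proof.
have mf : measurable_fun [set: measurableTypeR R]
    ((fun x => x - p) : measurableTypeR R -> measurableTypeR R).
  exact: measurable_funB.
pose mu := pushforward (@lebesgue_measure R)
  ((fun x => x - p) : measurableTypeR R -> measurableTypeR R).
pose mu' := measure_function_pushforward__canonical__measure_function_Measure
  (@lebesgue_measure R) mf.
move=> mA; apply/esym/(lebesgue_measure_unique (mu := mu')) => //= _ [[a b]] _ <-.
rewrite /mu /pushforward.
rewrite [X in _ = lebesgue_measure X](_ : _ = `]a + p, b + p]%classic); last first.
  by apply/seteqP; split => x /=; rewrite !in_itv/= ltrBrDr lerBlDr.
by rewrite !lebesgue_measure_itv/= !lte_fin ltrD2r -!EFinB opprD addrACA subrr addr0.
Qed.

(** Induction on the dimension: [cons_rV] turns the translation by [p] into the product [S] of a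
    translation of the line and one of the remaining coordinates. By uniqueness of the product
    measure, only rectangles have to be checked. *)
Lemma leb_translate n (p : 'rV[R]_n) (A : set 'rV[R]_n) : measurable A ->
  leb n (translate p A) = leb n A.
Proof.
elim: n p A => [p A _|n IH p A mA].
  by congr (_ _); apply/seteqP; split => x; rewrite /translate/= (thinmx0 (x - p)) (thinmx0 x).
pose S (z : measurableTypeR R * 'rV[R]_n) : measurableTypeR R * 'rV[R]_n :=
  ((z.1 : R) - p ord0 ord0, z.2 - (@uncons_rV R n p).2).
have mS : measurable_fun setT S.
  apply: measurable_fun_pair; first exact: measurable_funB.
  by apply: (measurableT_comp (@measurable_shift_rV n _)); exact: measurable_snd.
have mA' : measurable (@cons_rV R n @^-1` A).
  by rewrite -[X in measurable X]setTI; exact: measurable_cons_rV.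
pose mu := measure_function_pushforward__canonical__measure_function_Measure
  (@lebesgue_measure R \x leb n)%E mS.
transitivity (mu (@cons_rV R n @^-1` A)).
  rewrite /mu /= /leb_step /pushforward; congr (_ _).
  apply/seteqP; rewrite /translate; suff E (z : measurableTypeR R * 'rV[R]_n) :
    cons_rV z - p = cons_rV (S z) by split=> z /=; rewrite E.
  apply/rowP => i; rewrite [LHS]mxE [(- p) _ _]mxE.
  by case: (unliftP ord0 i) => [j ->|->]; rewrite ?cons_rVS ?cons_rV0// !mxE.
rewrite /= /leb_step {2}/pushforward.
apply/esym/product_measure_unique => // B C mB mC.
rewrite /mu /= /pushforward (_ : _ @^-1` _ = [set x | B ((x : R) - p ord0 ord0)] `*`
  translate (@uncons_rV R n p).2 C) //.
have mB' : measurable [set x : measurableTypeR R | B ((x : R) - p ord0 ord0)].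
  have mf : measurable_fun [set: measurableTypeR R]
    ((fun x => x - p ord0 ord0) : measurableTypeR R -> measurableTypeR R).
    exact: measurable_funB.
  by rewrite -[X in measurable X]setTI; exact: mf.
rewrite product_measure1E//; last exact: measurable_translate.
by rewrite IH//; congr (_ * _)%E; exact: lebesgue_measure_translate.
Qed.

Lemma measurable_box n (C : R) :
  measurable [set x : 'rV[R]_n | forall i, `|x ord0 i| <= C].
Proof.
rewrite (_ : [set _ | _] =
  \bigcap_(i in setT) [set x : 'rV[R]_n | `|x ord0 i| <= C]); last first.
  by apply/seteqP; split=> x /= h i; [move=> _; exact: h | exact: h].
apply: fin_bigcap_measurable => // i _.
apply: (measurable_sublevel (f := fun x : 'rV[R]_n => `|x ord0 i|)).
by apply: measurableT_comp => //; exact: measurable_coor.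
Qed.

Lemma leb_box n (C : R) :
  (leb n [set x : 'rV[R]_n | forall i, (`|x ord0 i| <= C)%R] < +oo)%E.
Proof.
elim: n => [|n IH].
  by rewrite /= diracE; case: (_ \in _); rewrite ltry.
rewrite /= /leb_step /pushforward.
rewrite (_ : _ @^-1` _ = [set t | `|t| <= C] `*`
    [set x : 'rV[R]_n | forall i, `|x ord0 i| <= C]); last first.
  apply/seteqP; split=> [[t x] /= h|[t x] /= [h1 h2] i].
    split=> [|i]; first by move: (h ord0); rewrite cons_rV0.
    by move: (h (lift ord0 i)); rewrite cons_rVS.
  by case: (unliftP ord0 i) => [j ->|->]; rewrite ?cons_rV0 ?cons_rVS.
have mI : measurable [set t : measurableTypeR R | `|t : R| <= C].
  rewrite (_ : [set _ | _] = `[- C, C]%classic) //.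
  by apply/seteqP; split=> t /=; rewrite in_itv/= ler_norml.
have mB := @measurable_box n C.
have lI : (@lebesgue_measure R [set t | (`|t| <= C)%R] < +oo)%E.
  rewrite (_ : [set _ | _] = `[- C, C]%classic); last first.
    by apply/seteqP; split=> t /=; rewrite in_itv/= ler_norml.
  by rewrite lebesgue_measure_itv; case: ifP => _; rewrite ltry.
rewrite product_measure1E// lte_mul_pinfty//.
by rewrite ge0_fin_numE//; exact: IH.
Qed.

Lemma measurable_hyperplane n (a : 'rV[R]_n) c : measurable [set x | dot a x = c].
Proof.
rewrite -[X in measurable X]setTI (_ : [set _ | _] = dot a @^-1` [set c])//.
exact: measurable_dot.
Qed.

(** If the tail [b] of the normal is nonzero, every section at a fixed first coordinate is a
    hyperplane of one dimension less, hence null by induction. If [b] is 0, the hyperplane is the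
    product of one point of the line with the whole remaining space. *)
Lemma leb_hyperplane n (a : 'rV[R]_n) c : a != 0 -> leb n [set x | dot a x = c] = 0%E.
Proof.
elim: n a c => [a c|n IH a c a0].
  by rewrite (thinmx0 a) eqxx.
pose b : 'rV[R]_n := \row_i a ord0 (lift ord0 i).
have dotE (z : measurableTypeR R * 'rV[R]_n) :
    dot a (cons_rV z) = a ord0 ord0 * (z.1 : R) + dot b z.2.
  rewrite /dot big_ord_recl cons_rV0; congr (_ + _).
  by apply: eq_bigr => i _; rewrite cons_rVS mxE.
rewrite /= /leb_step /pushforward.
rewrite (_ : _ @^-1` _ = [set z | a ord0 ord0 * (z.1 : R) + dot b z.2 = c]); last first.
  by apply/seteqP; split=> z /=; rewrite dotE.
have [b0|b0] := eqVneq b 0; last first.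
  rewrite /product_measure1; apply: integral0_eq => t _ /=.
  rewrite -(IH b (c - a ord0 ord0 * (t : R)) b0); congr (_ _).
  apply/seteqP; split=> x; rewrite /xsection /= inE /=; first by move=> <-; ring.
  by move=> ->; ring.
have a00 : a ord0 ord0 != 0.
  apply: contra a0 => /eqP a00; apply/eqP/rowP => i; rewrite mxE.
  case: (unliftP ord0 i) => [j ->|->//].
  by have /rowP/(_ j) := b0; rewrite !mxE.
rewrite (_ : [set _ | _] = [set c / a ord0 ord0] `*` setT); last first.
  apply/seteqP; split=> [[t x] /=|[t x] /= [-> _]]; last first.
    rewrite b0 /dot big1 ?addr0 => [|i _]; last by rewrite mxE mul0r.
    by rewrite mulrC divfK.
  rewrite b0 /dot big1 ?addr0 => [<-|i _]; last by rewrite mxE mul0r.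
  by rewrite mulrC mulKf.
rewrite product_measure1E//.
by have /= -> := lebesgue_measure_set1 (c / a ord0 ord0); rewrite mul0e.
Qed.

End lebesgue_rV_theory.

(** * Cells as bounded polytopes *)

Section geometry_theory.
Context {R : realType}.

Definition coor_bounded d (A : set 'rV[R]_d) :=
  exists C, forall x, A x -> forall i, `|x ord0 i| <= C.

Lemma coor_boundedS d (A B : set 'rV[R]_d) :
  A `<=` B -> coor_bounded B -> coor_bounded A.
Proof. by move=> AB [C hC]; exists C => x /AB; exact: hC. Qed.

Lemma leb_bounded d (A : set 'rV[R]_d) :
  measurable A -> coor_bounded A -> (leb d A < +oo)%E.
Proof.
move=> mA [C AC]; apply: le_lt_trans (leb_box d C).
apply: le_measure => //; rewrite inE//; exact: measurable_box.
Qed.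

Lemma dotC d (a b : 'rV[R]_d) : dot a b = dot b a.
Proof. by apply: eq_bigr => i _; rewrite mulrC. Qed.

Lemma dotDr d (a b c : 'rV[R]_d) : dot a (b + c) = dot a b + dot a c.
Proof. by rewrite /dot -big_split; apply: eq_bigr => i _; rewrite mxE mulrDr. Qed.

Lemma dotZr d (a b : 'rV[R]_d) t : dot a (t *: b) = t * dot a b.
Proof. by rewrite /dot mulr_sumr; apply: eq_bigr => i _; rewrite mxE mulrCA. Qed.

Lemma dotNr d (a b : 'rV[R]_d) : dot a (- b) = - dot a b.
Proof. by rewrite -scaleN1r dotZr mulN1r. Qed.

Lemma dotBr d (a b c : 'rV[R]_d) : dot a (b - c) = dot a b - dot a c.
Proof. by rewrite dotDr dotNr. Qed.

Lemma dotNl d (a b : 'rV[R]_d) : dot (- a) b = - dot a b.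
Proof. by rewrite dotC dotNr dotC. Qed.

Lemma dot_gt0 d (a : 'rV[R]_d) : a != 0 -> 0 < dot a a.
Proof.
move=> a0; rewrite lt_neqAle sumr_ge0 ?andbT => [|i _]; last by rewrite -expr2 sqr_ge0.
apply: contra a0; rewrite eq_sym psumr_eq0 => [/allP h|i _]; last by rewrite -expr2 sqr_ge0.
apply/eqP/rowP => i; rewrite mxE.
by have := h i (mem_index_enum _); rewrite -expr2 sqrf_eq0 => /eqP.
Qed.

Lemma dot_delta d (i : 'I_d) (x : 'rV[R]_d) : dot (delta_mx ord0 i) x = x ord0 i.
Proof.
rewrite /dot (bigD1 i)//= big1 => [|j ji]; first by rewrite mxE !eqxx mul1r addr0.
by rewrite mxE (negbTE ji) andbF mul0r.
Qed.

Lemma forall_consE (T : eqType) (U : Type) (P : T -> U -> Prop) h L :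
  [set x | forall h', h' \in h :: L -> P h' x] =
  [set x | P h x] `&` [set x | forall h', h' \in L -> P h' x].
Proof.
apply/seteqP; split=> x /=.
  by move=> hP; split=> [|h' h'L]; apply: hP; rewrite inE ?eqxx ?h'L ?orbT.
by move=> [hP hL] h'; rewrite inE => /orP[/eqP->//|]; exact: hL.
Qed.

Definition halfspaces d (L : seq ('rV[R]_d * R)) : set 'rV[R]_d :=
  [set x | forall H, H \in L -> dot H.1 x <= H.2].

(** A simplex is the set where all barycentric coordinates, which are affine in [x], are
    nonnegative. The nonzero normals are what later makes interiors strict and boundaries null. *)
Lemma cell_halfspaces d (K : element R d) : (0 < d)%N -> Defs.nondegenerate K ->
  exists2 L, (forall H, H \in L -> H.1 != 0) & cell K = halfspaces L.
Proof.
case: K => [a b|P] d0 ndK.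
  have dn i : delta_mx ord0 i != 0 :> 'rV[R]_d.
    by apply/eqP => /rowP/(_ i)/eqP; rewrite !mxE !eqxx oner_eq0.
  exists (facets (Cartesian a b)) => [H|].
    by rewrite mem_cat => /orP[] /mapP[i _ ->]; rewrite ?oppr_eq0 dn.
  apply/seteqP; split=> x /= h.
    move=> H; rewrite mem_cat => /orP[] /mapP[i _ ->] /=;
      by rewrite ?dotNl dot_delta ?lerN2; case/andP: (h i).
  move=> i; have ha := h (- delta_mx ord0 i, - a ord0 i).
  have hb := h (delta_mx ord0 i, b ord0 i).
  move: ha hb; rewrite /= dotNl dot_delta lerN2 !mem_cat => -> => [->//|].
    by apply/orP; right; apply/mapP; exists i; rewrite ?mem_enum.
  by apply/orP; left; apply/mapP; exists i; rewrite ?mem_enum.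
rewrite /= in ndK; set S := simplex_mx P in ndK.
pose A := invmx S.
(* al j + dot (g j) x is the j-th barycentric coordinate of x. *)
pose g j : 'rV[R]_d := \row_l A (rshift 1 l) j.
pose al j := A (lshift d ord0) j.
have bary (x : 'rV[R]_d) j :
    (row_mx (const_mx 1 : 'rV[R]_1) x *m A) ord0 j = al j + dot (g j) x.
  rewrite mxE big_split_ord /= big_ord1 row_mxEl !mxE mul1r; congr (_ + _).
  by apply: eq_bigr => l _; rewrite row_mxEr !mxE mulrC.
exists [seq (- g j, al j) | j <- enum 'I_(1 + d)] => [H|].
  (* If [g j] were 0, the j-th barycentric coordinate would be the constant [al j]; but it is 1 at
     the j-th vertex and 0 at any other, and another vertex exists because [d] is positive. *)
  move=> /mapP[j _ ->] /=; rewrite oppr_eq0; apply/eqP => gj0.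
  have SA k : al j = (k == j)%:R.
    have := mulmxV ndK => /matrixP/(_ k j).
    rewrite mxE big_split_ord /= big_ord1 row_mxEl !mxE mul1r big1 ?addr0// => l _.
    by have /rowP/(_ l) := gj0; rewrite !mxE => ->; rewrite mulr0.
  have [k kj] : exists k : 'I_(1 + d), k != j.
    have [->|j0] := eqVneq j ord0; last by exists ord0; rewrite eq_sym.
    by exists (rshift 1 (Ordinal d0)).
  by have := SA k; rewrite (SA j) eqxx (negbTE kj) => /eqP; rewrite oner_eq0.
apply/seteqP; split=> x /=.
  move=> [w [w0 w1 xE]] H /mapP[j _ ->] /=.
  rewrite dotNl lerNl -subr_ge0 opprK addrC -bary.
  rewrite (_ : row_mx _ _ = w *m S) ?mulmxK//.
  rewrite /S /simplex_mx (mul_mx_row w) -xE; congr row_mx.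
  apply/rowP => i; rewrite !mxE -[LHS]w1; apply: eq_bigr => k _.
  by rewrite mxE mulr1.
move=> h; have [w wE] : exists w, w = row_mx (const_mx 1 : 'rV[R]_1) x *m A.
  by exists (row_mx (const_mx 1) x *m A).
(* Read blockwise, $(1,x)=wS$ says both that the weights sum to 1 and that [x] is [w *m P]. *)
have := mulmxKV ndK (row_mx (const_mx 1 : 'rV[R]_1) x).
rewrite -/A -wE /S /simplex_mx (mul_mx_row w) => /eq_row_mx[w1 wP].
exists w; split=> // [j|].
  have /(_ _)/= := h (- g j, al j).
  rewrite dotNl lerNl -subr_ge0 opprK addrC -bary -wE; apply.
  by apply/mapP; exists j; rewrite ?mem_enum.
have /rowP/(_ ord0) := w1; rewrite !mxE => <-.
by apply: eq_bigr => j _; rewrite mxE mulr1.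
Qed.

Lemma cell_bounded d (K : element R d) : coor_bounded (cell K).
Proof.
case: K => [a b|P].
  exists (\sum_i (`|a ord0 i| + `|b ord0 i|)) => x /= h i.
  have /andP[ha hb] := h i.
  apply: (@le_trans _ _ (`|a ord0 i| + `|b ord0 i|)).
    rewrite ler_norml; have := ler_norm (b ord0 i); have := lerNnormlW (lexx `|a ord0 i|).
    have := normr_ge0 (b ord0 i); have := normr_ge0 (a ord0 i); lra.
  by rewrite (bigD1 i)//= lerDl sumr_ge0// => j _; rewrite addr_ge0.
exists (\sum_i \sum_j `|P j i|) => x /= [w [w0 w1 ->]] i.
apply: (@le_trans _ _ (\sum_j `|P j i|)); last first.
  by rewrite (bigD1 i)//= lerDl sumr_ge0// => j _; rewrite sumr_ge0.
rewrite mxE (le_trans (ler_norm_sum _ _ _))// ler_sum// => j _.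
rewrite normrM ler_piMl// ger0_norm// -w1 (bigD1 j)//= lerDl.
by rewrite sumr_ge0.
Qed.

Lemma measurable_halfspaces d (L : seq ('rV[R]_d * R)) : measurable (halfspaces L).
Proof.
elim: L => [|H L IH].
  by rewrite (_ : halfspaces _ = setT)//; apply/seteqP; split.
rewrite /halfspaces forall_consE.
by apply: measurableI => //; apply: measurable_sublevel; exact: measurable_dot.
Qed.

Lemma measurable_cell d (K : element R d) : (0 < d)%N -> Defs.nondegenerate K ->
  measurable (cell K).
Proof.
by move=> d0 /(cell_halfspaces d0)[L _ ->]; exact: measurable_halfspaces.
Qed.

Lemma continuous_dot d (a : 'rV[R]_d) : continuous (dot a).
Proof.
rewrite (_ : dot a = fun y => \sum_i a ord0 i * y ord0 i)//.
apply: continuous_big => [|i _ x]; first exact: add_continuous.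
by apply: continuousM; [exact: cst_continuous | exact: coord_continuous].
Qed.

(** At a point with equality for [H], an arbitrarily small move along [H.1] leaves the half-space,
    since [dot H.1 H.1] is positive. Conversely, finitely many strict inequalities cut out an open
    set. *)
Lemma interior_halfspaces d (L : seq ('rV[R]_d * R)) :
  (forall H, H \in L -> H.1 != 0) ->
  (halfspaces L)° = [set x | forall H, H \in L -> dot H.1 x < H.2].
Proof.
move=> L0; apply/seteqP; split=> x.
  move=> /nbhs_ballP[e /= e0 xeL] H HL.
  (* With this [t] the displacement [t *: H.1] has norm below [e]; the added 1 keeps the denominator
     positive without further case analysis. *)
  pose t := e / (2 * (`|H.1| + 1)).
  have n0 := normr_ge0 H.1.
  have t0 : 0 < t by rewrite divr_gt0// mulr_gt0// ltr_wpDl.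
  have : halfspaces L (x + t *: H.1).
    apply: xeL; rewrite -ball_normE /ball_/= opprD addNKr normrN normrZ gtr0_norm//.
    rewrite /t mulrAC ltr_pdivrMr ?mulr_gt0 ?ltr_wpDl// ltr_pM2l//.
    by move: n0; lra.
  move/(_ H HL); rewrite dotDr dotZr; apply: lt_le_trans.
  by rewrite ltrDl mulr_gt0// dot_gt0// L0.
move=> h; pose O := [set x | forall H, H \in L -> dot H.1 x < H.2].
suff oO : open O.
  by apply: filterS (open_nbhs_nbhs (conj oO h)) => y hy H HL; exact/ltW/hy.
rewrite {}/O {L0 h x}; elim: L => [|H L IH].
  by rewrite (_ : [set _ | _] = setT); [exact: openT|apply/seteqP; split].
rewrite (forall_consE (fun H x => dot H.1 x < H.2)).
apply: openI => //; apply: (@open_comp _ _ (dot H.1) [set y | y < H.2]).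
  by move=> y _; exact: continuous_dot.
exact: open_lt.
Qed.

End geometry_theory.

(** * Cell boundaries are null sets *)

Section interior.
Context {R : realType} {d : nat}.

(** A point of the cell outside its interior satisfies one of the finitely many defining
    inequalities with equality, so the difference lies in a finite union of null hyperplanes. *)
Lemma leb_cell_boundary (K : element R d) : (0 < d)%N -> Defs.nondegenerate K ->
  measurable (cell K)° /\ leb d (cell K `\` (cell K)°) = 0%E.
Proof.
move=> d0 ndK; have [L L0 KL] := cell_halfspaces d0 ndK.
have mK := measurable_cell d0 ndK.
have mI : measurable (cell K)°.
  rewrite KL interior_halfspaces// {KL L0}; elim: L => [|H L IH].
    by rewrite (_ : [set _ | _] = setT)//; apply/seteqP; split.
  rewrite (forall_consE (fun H x => dot H.1 x < H.2)); apply: measurableI => //.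
  rewrite (_ : [set _ | _] = ~` [set x | dot (- H.1) x <= - H.2]).
    apply/measurableC; apply: measurable_sublevel; exact: measurable_dot.
  by apply/seteqP; split=> x /=; rewrite dotNl lerN2 ltNge => /negP.
split=> //.
have [N [mN N0 BN]] : exists N, [/\ measurable N, leb d N = 0%E &
    [set x | exists2 H, H \in L & dot H.1 x = H.2] `<=` N].
  elim: L L0 {KL} => [_|H L IH L0].
    by exists set0; split=> [//||x /= [H]//]; rewrite measure0.
  have [|N [mN N0 BN]] := IH; first by move=> H' h; apply: L0; rewrite inE h orbT.
  have mH := measurable_hyperplane H.1 H.2.
  exists (N `|` [set x | dot H.1 x = H.2]); split.
  - exact: measurableU.
  - have H0 := leb_hyperplane H.2 (L0 H (mem_head _ _)).
    by rewrite measureU0.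
  - move=> x /= [H']; rewrite inE => /orP[/eqP->|H'L] e; first by right.
    by left; apply: BN; exists H'.
apply: (subset_measure0 _ mN _ N0); first exact: measurableD.
move=> x [Kx nI]; apply: BN; apply: contrapT => nH; apply: nI.
rewrite KL interior_halfspaces// => H HL; rewrite KL in Kx.
rewrite lt_neqAle Kx// andbT; apply/eqP => e; apply: nH; by exists H.
Qed.

Lemma Rintegral_interior (K : element R d) (f : 'rV[R]_d -> R) :
  (0 < d)%N -> Defs.nondegenerate K -> bmfun (cell K) f ->
  \int[leb d]_(x in (cell K)°) f x = \int[leb d]_(x in cell K) f x.
Proof.
move=> d0 ndK bf; have [mI K0] := leb_cell_boundary d0 ndK.
have mK := measurable_cell d0 ndK.
have fK := leb_bounded mK (cell_bounded K).
have mD : measurable (cell K `\` (cell K)°) by exact: measurableD.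
congr fine; rewrite [RHS](negligible_integral mD mK)//; last exact: bmfun_integrable.
by rewrite setDD setIidr//; exact: interior_subset.
Qed.

End interior.

(** * Surface integrals and numerical fluxes *)

Section surface.
Context {R : realType} {d : nat}.
Implicit Types (F : 'rV[R]_d * R) (A S : set 'rV[R]_d).

(** By translation invariance [leb d] coincides with its image under the shift [phi], and the change
    of variables formula for image measures applies to the extension of [k] by zero. *)
Lemma Rintegral_translate p A (k : 'rV[R]_d -> R) :
  measurable A -> (leb d A < +oo)%E -> bmfun A k ->
  \int[leb d]_(y in translate p A) k (y - p) = \int[leb d]_(x in A) k x.
Proof.
move=> mA Afin bk; congr fine.
rewrite [LHS]integral_mkcond [RHS]integral_mkcond.
pose k' : 'rV[R]_d -> \bar R := (EFin \o k) \_ A.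
pose phi (y : 'rV[R]_d) := y - p.
have mk' : measurable_fun setT k'.
  apply: (measurable_restrictT (EFin \o k) mA).1.
  by apply: measurableT_comp => //; case: bk.
have mphi : measurable_fun setT phi := @measurable_shift_rV R d p.
have -> : (fun y => (k (y - p))%:E) \_ (translate p A) = k' \o phi.
  by apply/funext => y; rewrite /k' /phi /= !patchE.
have ik' : (leb d).-integrable setT k'.
  by apply: (integrable_mkcond _ mA).1; exact: bmfun_integrable.
pose mu := measure_function_pushforward__canonical__measure_function_Measure
  (leb d) mphi.
have E (f : 'rV[R]_d -> \bar R) :
    (\int[leb d]_x f x = \int[mu]_x f x)%E.
  by apply: eq_measure_integral => D mD _; rewrite /mu /= -(leb_translate p mD).
have iphi : (leb d).-integrable (phi @^-1` setT) (k' \o phi).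
  rewrite preimage_setT; apply/integrableP; split; first exact: measurableT_comp.
  move/integrableP : (ik') => [_]; apply: le_lt_trans.
  by rewrite [leRHS]E ge0_integral_pushforward//; apply: measurableT_comp.
by rewrite [RHS]E (integral_pushforward mphi mk' iphi)//.
Qed.

Definition prism F A : set 'rV[R]_d :=
  [set x | `|dot F.1 x - F.2| <= 2^-1 /\ A (hyperplane_proj F x)].

Lemma measurable_hyperplane_proj F : measurable_fun setT (hyperplane_proj F).
Proof.
apply/measurable_fun_rVP => i; under eq_fun do rewrite !mxE.
apply: measurable_funB; first exact: measurable_coor.
apply: measurable_funM => //; apply: measurable_funB => //; exact: measurable_dot.
Qed.

Lemma measurable_prism F A : measurable A -> measurable (prism F A).
Proof.
move=> mA; apply: measurableI.
  apply: (measurable_sublevel (f := fun x => `|dot F.1 x - F.2|)).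
  apply: measurableT_comp => //; apply: measurable_funB => //; exact: measurable_dot.
by rewrite -[X in measurable X]setTI; exact: measurable_hyperplane_proj.
Qed.

Lemma prism_bounded F A : coor_bounded A -> coor_bounded (prism F A).
Proof.
move=> [C AC]; exists (C + \sum_i `|F.1 ord0 i|) => x [Fx /AC h] i.
have -> : x = hyperplane_proj F x + (dot F.1 x - F.2) *: F.1 by rewrite subrK.
rewrite mxE (le_trans (ler_normD _ _))// lerD// mxE normrM.
apply: (@le_trans _ _ `|F.1 ord0 i|).
  by rewrite ler_piMl// (le_trans Fx)// invf_le1// ler1n.
by rewrite (bigD1 i)//= lerDl sumr_ge0.
Qed.

Lemma bmfun_hyperplane_proj F A i : coor_bounded A ->
  bmfun (prism F A) (fun x => hyperplane_proj F x ord0 i).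
Proof.
move=> [C AC]; split; last by exists C => x [_ /AC].
apply: measurable_funTS; apply: (measurableT_comp (measurable_coor i)).
exact: measurable_hyperplane_proj.
Qed.

(** The field [a] enters only through the scalar [dot a n]. The first term is odd in [n] and
    symmetric in the traces, the second even in [n] and antisymmetric in the traces; so the flux
    changes sign when the two sides are exchanged. The factor [dot n n] keeps the identity valid for
    normals of any length. *)
Lemma numerical_fluxE s (a n : 'rV[R]_d) fp fm :
  numerical_flux s a n (- n) fp fm =
  dot a n * (2^-1 * (fp + fm)) + `|dot a n| * (s / 2 * dot n n * (fp - fm)).
Proof.
rewrite /numerical_flux -scalerDl scalerA scalerN -scalerBl scalerA.
rewrite dotC dotDr !dotZr (dotC n a).
by ring.
Qed.

Lemma numerical_fluxN s (a n : 'rV[R]_d) fp fm :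
  numerical_flux s a (- n) n fm fp = - numerical_flux s a n (- n) fp fm.
Proof.
rewrite -{2}(opprK n) !numerical_fluxE dotNr dotNl dotNr normrN; ring.
Qed.

End surface.

(** * The flux through one face: integrability, antisymmetry, finitely many periods *)

Section surface_flux.
Context {R : realType} {d : nat}.
Implicit Types (F : 'rV[R]_d * R) (A S : set 'rV[R]_d) (p : 'rV[R]_d).

(** The scalars [dot (a u) F.1] and its absolute value come out of the surface integral. What
    remains, the partial integrals of [h1] and [h2], is bounded in [u], so integrability of
    [dot (a u) F.1] suffices. *)
Lemma integrable_surface_flux K s (a : 'rV[R]_d -> 'rV[R]_d) F S
    (P Q : 'rV[R]_d -> 'rV[R]_d -> R) :
  measurable K -> (leb d K < +oo)%E -> measurable S -> coor_bounded S ->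
  bmfun (K `*` prism F S) (fun z => P z.1 (hyperplane_proj F z.2)) ->
  bmfun (K `*` prism F S) (fun z => Q z.1 (hyperplane_proj F z.2)) ->
  (leb d).-integrable K (EFin \o (fun u => dot (a u) F.1)) ->
  (leb d).-integrable K (EFin \o (fun u => surface_integral F S
    (fun x => numerical_flux s (a u) F.1 (- F.1) (P u x) (Q u x)))).
Proof.
move=> mK Kfin mS bS bP bQ ia.
have mD := measurable_prism F mS.
have Dfin := leb_bounded mD (prism_bounded F bS).
pose h1 (z : 'rV[R]_d * 'rV[R]_d) :=
  2^-1 * (P z.1 (hyperplane_proj F z.2) + Q z.1 (hyperplane_proj F z.2)).
pose h2 (z : 'rV[R]_d * 'rV[R]_d) := s / 2 * dot F.1 F.1 *
  (P z.1 (hyperplane_proj F z.2) + -1 * Q z.1 (hyperplane_proj F z.2)).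
have bh1 : bmfun (K `*` prism F S) h1.
  by apply: bmfunM; [exact: bmfun_cst|exact: bmfunD].
have bh2 : bmfun (K `*` prism F S) h2.
  apply: bmfunM; first exact: bmfun_cst.
  by apply: bmfunD => //; apply: bmfunM => //; exact: bmfun_cst.
apply: (eq_integrable mK (EFin \o (fun u =>
  (\int[leb d]_(y in prism F S) h1 (u, y)) * dot (a u) F.1 +
  (\int[leb d]_(y in prism F S) h2 (u, y)) * `|dot (a u) F.1|))).
  move=> u; rewrite inE => Ku /=; congr (_%:E).
  have i1 := bmfun_integrable mD Dfin (bmfun_section mK mD Ku bh1).
  have i2 := bmfun_integrable mD Dfin (bmfun_section mK mD Ku bh2).
  rewrite [in LHS]mulrC [X in _ + X]mulrC -!RintegralZl// -RintegralD//.
  - apply: eq_Rintegral => y _; rewrite numerical_fluxE /h1 /h2 /=; ring.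
  - have -> : (EFin \o (fun y => dot (a u) F.1 * h1 (u, y))) =
      (fun y => (dot (a u) F.1)%:E * (EFin \o (fun y => h1 (u, y))) y)%E.
      by apply/funext => y /=; rewrite EFinM.
    exact: integrableZl.
  - have -> : (EFin \o (fun y => `|dot (a u) F.1| * h2 (u, y))) =
      (fun y => (`|dot (a u) F.1|)%:E * (EFin \o (fun y => h2 (u, y))) y)%E.
      by apply/funext => y /=; rewrite EFinM.
    exact: integrableZl.
have := integrableD mK
  (integrable_bmfunM mK (bmfun_Rintegral mK mD Kfin Dfin bh1) ia)
  (integrable_bmfunM mK (bmfun_Rintegral mK mD Kfin Dfin bh2)
    (integrable_norm ia)).
by [].
Qed.

Lemma bmfun_translate p A (k : 'rV[R]_d -> R) : measurable A -> bmfun A k ->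
  bmfun (translate p A) (fun y => k (y - p)).
Proof.
move=> mA [mk [C kC]]; split; last by exists C => x Ax; exact: kC Ax.
apply: (measurable_comp mA _ mk) => [_ [y Ay <-]//|].
by apply: measurable_funTS; exact: measurable_shift_rV.
Qed.

(* If dot F.1 p <> F.2 + F'.2, the hyperplane of F and that of F' translated by
   p are distinct and both integrals are over the empty set; otherwise the
   translation by p maps the prism over F' to the prism over F. *)
Lemma surface_integral_fluxN s a F F' p A A' (P Q : 'rV[R]_d -> R) :
  F'.1 = - F.1 -> measurable A -> measurable A' -> coor_bounded A ->
  A `<=` [set x | dot F.1 x = F.2] -> A' `<=` [set x | dot F'.1 x = F'.2] ->
  bmfun (prism F (A `&` translate p A')) (fun x => P (hyperplane_proj F x)) ->
  bmfun (prism F (A `&` translate p A')) (fun x => Q (hyperplane_proj F x - p)) ->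
  surface_integral F' (A' `&` translate (- p) A)
    (fun y => numerical_flux s a F'.1 F.1 (Q y) (P (y - - p))) =
  - surface_integral F (A `&` translate p A')
    (fun x => numerical_flux s a F.1 F'.1 (P x) (Q (x - p))).
Proof.
move=> FF' mA mA' bA AF AF' bP bQ.
have [Fp|Fp] := eqVneq (dot F.1 p) (F.2 + F'.2); last first.
  rewrite /surface_integral.
  rewrite (_ : [set _ | _] = set0) ?Rintegral_set0.
    rewrite (_ : [set _ | _] = set0) ?Rintegral_set0 ?oppr0//.
    apply/seteqP; split=> // x [_ /=]; move: (hyperplane_proj F x) => y [/AF + /AF'] /=.
    rewrite FF' dotBr !dotNl opprK => -> e; case/eqP: Fp; rewrite -e; ring.
  apply/seteqP; split=> // x [_ /=]; move: (hyperplane_proj F' x) => y [/AF' + /AF] /=.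
  rewrite /= FF' dotBr dotNr !dotNl opprK => e1 e2; case/eqP: Fp; rewrite -e1 -e2; ring.
set S := A `&` translate p A'.
have mS : measurable S by apply: measurableI => //; exact: measurable_translate.
have bS : coor_bounded S by apply: coor_boundedS bA; exact: subIsetl.
have mD := measurable_prism F mS.
have Dfin := leb_bounded mD (prism_bounded F bS).
(* By [Fp], the signed offset of $x+p$ from the hyperplane of [F] is the opposite of that of $x$
   from the hyperplane of [F']. As the normals are opposite too, projection commutes with the
   translation. *)
have projE (x : 'rV[R]_d) : hyperplane_proj F (x - - p) = hyperplane_proj F' x + p.
  rewrite /hyperplane_proj FF' opprK dotDr dotNl Fp scalerN -scaleNr opprB addrAC.
  by congr (_ - _ *: _ + _); ring.
have DE : prism F' (A' `&` translate (- p) A) = translate (- p) (prism F S).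
  have absE x : `|dot F'.1 x - F'.2| = `|dot F.1 (x - - p) - F.2|.
    by rewrite FF' opprK dotDr dotNl Fp -normrN; congr (`|_|); ring.
  apply/seteqP; split=> x; rewrite /S /prism /translate /= absE projE opprK addrK.
    by move=> [? []].
  by move=> [? []].
pose k x := numerical_flux s a F.1 F'.1
  (P (hyperplane_proj F x)) (Q (hyperplane_proj F x - p)).
have bk : bmfun (prism F S) k.
  rewrite /k FF'; under eq_fun do rewrite numerical_fluxE.
  apply: bmfunD; apply: bmfunM; try exact: bmfun_cst.
    by apply: bmfunM; [exact: bmfun_cst | exact: bmfunD].
  apply: bmfunM; first exact: bmfun_cst.
  under eq_fun do rewrite -[- Q _]mulN1r.
  by apply: bmfunD => //; apply: bmfunM => //; exact: bmfun_cst.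
rewrite -mulN1r -[X in -1 * X]/(\int[leb d]_(x in prism F S) k x).
rewrite -(Rintegral_translate (- p) mD Dfin bk) -RintegralZl; last 2 first.
- exact: measurable_translate.
- apply: bmfun_integrable; first exact: measurable_translate.
    by have /= -> := leb_translate (- p) mD.
  exact: bmfun_translate.
rewrite /surface_integral -/(prism _ _) DE; apply: eq_Rintegral => y _.
rewrite /k projE addrK opprK mulN1r FF' numerical_fluxN //.
Qed.

(** A meeting point bounds the period vector, and the inverse of [per] turns this into a bound on
    the integer coordinates of [z]. *)
Lemma finite_periods (per : 'M[R]_d) A A' : per \in unitmx ->
  coor_bounded A -> coor_bounded A' ->
  finite_set [set z | A `&` translate (period per z) A' !=set0].
Proof.
move=> uper [C AC] [C' AC'].
(* [D] bounds all coordinates of [z] at once, by summing over all entries of the inverse matrix; the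
   absolute values make it nonnegative. [phi] enumerates the integer vectors with coordinates from
   $-N$ to $N$, hence $2N+1$ values for each. *)
pose D := (`|C| + `|C'|) * \sum_i \sum_j `|invmx per j i|.
pose N := Num.bound D.
pose phi (f : {ffun 'I_d -> 'I_(N + N).+1}) : 'rV[int]_d :=
  \row_i ((f i)%:Z - N%:Z).
apply: (@sub_finite_set _ _ (phi @` setT)); last exact/finite_image/finite_finset.
move=> z [x [/AC hA /AC' hA']].
have hz i : `|z ord0 i| <= N%:Z.
  have pz j : `|period per z ord0 j| <= `|C| + `|C'|.
    have -> : period per z ord0 j = x ord0 j - (x - period per z) ord0 j.
      by rewrite !mxE opprB addrC subrK.
    rewrite (le_trans (ler_normB _ _))// lerD//.
      exact: le_trans (hA j) (ler_norm _).
    exact: le_trans (hA' j) (ler_norm _).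
  have zE : (z ord0 i)%:~R = (period per z *m invmx per) ord0 i :> R.
    by rewrite /period mulmxK// mxE.
  rewrite -(ler_int R) -[X in _ <= X]/(N%:R) intr_norm zE.
  apply: (@le_trans _ _ D); last first.
    rewrite ltW// archi_boundP// mulr_ge0 ?addr_ge0//.
    by apply: sumr_ge0 => k _; exact: sumr_ge0.
  rewrite mxE (le_trans (ler_norm_sum _ _ _))//.
  apply: (@le_trans _ _ ((`|C| + `|C'|) * \sum_j `|invmx per j i|)).
    by rewrite mulr_sumr ler_sum// => j _; rewrite normrM ler_wpM2r.
  rewrite ler_wpM2l ?addr_ge0// [leRHS](bigD1 i)//= lerDl.
  by apply: sumr_ge0 => j _; exact: sumr_ge0.
exists [ffun i => inord (absz (z ord0 i + N%:Z))] => //.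
apply/rowP => i; rewrite mxE ffunE.
have /ler_normlP[h1 h2] := hz i.
have h0 : 0 <= z ord0 i + N%:Z by rewrite -lerBlDr sub0r lerNl.
rewrite inordK; first by rewrite gez0_abs// addrK.
by rewrite ltnS -lez_nat gez0_abs// PoszD lerD2r.
Qed.

Lemma bmfun_ev disp (T : measurableType disp) (D : set T) (x v : T -> 'rV[R]_d) g :
  (forall l, bmfun D (fun t => x t ord0 l)) ->
  (forall l, bmfun D (fun t => v t ord0 l)) ->
  bmfun D (fun t => ev g (x t) (v t)).
Proof.
move=> bx bv; apply: bmfun_meval => i.
have [j ->|j ->] := split_ordP i.
  by under eq_fun do rewrite row_mxEl; exact: bx.
by under eq_fun do rewrite row_mxEr; exact: bv.
Qed.

Lemma bmfun_coor A i : measurable A -> coor_bounded A ->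
  bmfun A (fun x : 'rV[R]_d => x ord0 i).
Proof.
move=> mA [C AC]; split; last by exists C => x /AC.
by apply: measurable_funTS; exact: measurable_coor.
Qed.

End surface_flux.

(** Exchanging the pairs (i, F) and (i', F') changes the sign of every term, so the sum equals its
    own opposite. The case $i=i'$ is included, as an element may face a periodic copy of itself. *)
Lemma sum_antisymmetric {R : realDomainType} (I T : Type) (s : seq I) (L : I -> seq T)
    (c : rel T) (U : I -> T -> I -> T -> R) :
  (forall F F', c F F' = c F' F) ->
  (forall i F i' F', c F F' -> U i' F' i F = - U i F i' F') ->
  \sum_(i <- s) \sum_(F <- L i) \sum_(i' <- s) \sum_(F' <- L i' | c F F') U i F i' F' = 0.
Proof.
move=> cC UN.
pose V i i' := \sum_(F <- L i) \sum_(F' <- L i' | c F F') U i F i' F'.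
have VN i i' : V i' i = - V i i'.
  rewrite /V; under eq_bigr do rewrite big_mkcond.
  rewrite exchange_big -sumrN; apply: eq_bigr => F _ /=.
  rewrite -sumrN [RHS]big_mkcond /=; apply: eq_bigr => F' _.
  by rewrite cC; case: ifPn => // /UN.
rewrite [LHS](_ : _ = \sum_(i <- s) \sum_(i' <- s) V i i'); last first.
  by apply: eq_bigr => i _; rewrite exchange_big.
set X := LHS; suff : X = - X.
  by move=> /eqP; rewrite -subr_eq0 opprK -mulr2n mulrn_eq0 => /eqP.
rewrite /X {1}exchange_big -sumrN; apply: eq_bigr => i _.
by rewrite -sumrN; apply: eq_bigr => i' _; rewrite VN.
Qed.

(** * Cancellation of the fluxes *)

Section DG_theory.
Context {R : realType} {d : nat} (d_gt0 : (0 < d)%N) (M : phase_mesh R d).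
Implicit Types (f : dgfun M) (E : 'rV[R]_d -> 'rV[R]_d).

Local Notation Kx i := (cell (mesh_x M i)).
Local Notation Kv j := (cell (mesh_v M j)).

Lemma nondegenerate_x i : Defs.nondegenerate (mesh_x M i).
Proof. by have [] := mesh_x_partition M. Qed.

Lemma nondegenerate_v j : Defs.nondegenerate (mesh_v M j).
Proof. by have [] := mesh_v_partition M. Qed.

Lemma cell_sub_x i : Kx i `<=` Omega_x M.
Proof. by have [_ -> _] := mesh_x_partition M => x Kx; exists i. Qed.

Lemma cell_sub_v j : Kv j `<=` Omega_v M.
Proof. by have [_ -> _] := mesh_v_partition M => x Kx; exists j. Qed.

Lemma bigcup_ord_bounded N (T : 'I_N -> element R d) :
  coor_bounded (\bigcup_(i in [set: 'I_N]) cell (T i)).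
Proof.
have /choice[C hC] i : exists C, forall x, cell (T i) x -> forall l, `|x ord0 l| <= C.
  exact: cell_bounded.
exists (\sum_i `|C i|) => x [i _ Tx] l.
rewrite (le_trans (hC i x Tx l))// (le_trans (ler_norm _))//.
by rewrite (bigD1 i)//= lerDl sumr_ge0.
Qed.

Lemma partition_measurable N (T : 'I_N -> element R d) Omega :
  is_partition T Omega -> measurable Omega.
Proof.
move=> [nd -> _]; apply: fin_bigcup_measurable => // i _.
exact: measurable_cell.
Qed.

Lemma partition_bounded N (T : 'I_N -> element R d) Omega :
  is_partition T Omega -> coor_bounded Omega.
Proof. by move=> [_ -> _]; exact: bigcup_ord_bounded. Qed.

Let mx i : measurable (Kx i) := measurable_cell d_gt0 (nondegenerate_x i).
Let mv j : measurable (Kv j) := measurable_cell d_gt0 (nondegenerate_v j).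
Let fx i : (leb d (Kx i) < +oo)%E := leb_bounded (mx i) (cell_bounded _).
Let fv j : (leb d (Kv j) < +oo)%E := leb_bounded (mv j) (cell_bounded _).
Let mOx := partition_measurable (mesh_x_partition M).
Let mOv := partition_measurable (mesh_v_partition M).
Let bOx := partition_bounded (mesh_x_partition M).
Let bOv := partition_bounded (mesh_v_partition M).
Let fOx : (leb d (Omega_x M) < +oo)%E := leb_bounded mOx bOx.
Let fOv : (leb d (Omega_v M) < +oo)%E := leb_bounded mOv bOv.

Lemma bmfun_ev_prod A C g : measurable A -> coor_bounded A ->
  measurable C -> coor_bounded C ->
  bmfun (A `*` C) (fun z : 'rV[R]_d * 'rV[R]_d => ev g z.1 z.2).
Proof.
move=> mA bA mC bC; apply: bmfun_ev => l /=.
  by apply: (bmfun_fst (f := fun x : 'rV[R]_d => x ord0 l) mA mC); exact: bmfun_coor.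
by apply: (bmfun_snd (f := fun x : 'rV[R]_d => x ord0 l) mA mC); exact: bmfun_coor.
Qed.

Lemma bmfun_dgval f : bmfun (Omega_x M `*` Omega_v M) (fun z => dgval f z.1 z.2).
Proof.
apply: bmfun_sum => i _; apply: bmfun_sum => j _; apply: bmfunM.
  under eq_fun do rewrite -surjective_pairing.
  apply: bmfun_indic; apply: measurableX.
    by have [] := leb_cell_boundary d_gt0 (nondegenerate_x i).
  by have [] := leb_cell_boundary d_gt0 (nondegenerate_v j).
exact: bmfun_ev_prod.
Qed.

Lemma integrable_current f : integrable_field M (current f).
Proof.
move=> l; apply: (bmfun_integrable mOx fOx).
under eq_fun do rewrite mxE.
have b : bmfun (Omega_x M `*` Omega_v M) (fun z => dgval f z.1 z.2 * z.2 ord0 l).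
  apply: bmfunM; first exact: bmfun_dgval.
  by apply: (bmfun_snd (f := fun x : 'rV[R]_d => x ord0 l) mOx mOv); exact: bmfun_coor.
exact: (bmfun_Rintegral mOx mOv fOx fOv b).
Qed.

Lemma Rintegral_indic_interior (K : element R d) Omega (g : 'rV[R]_d -> R) :
  Defs.nondegenerate K -> cell K `<=` Omega -> bmfun (cell K) g ->
  \int[leb d]_(x in Omega) (\1_((cell K)°) x * g x) = \int[leb d]_(x in cell K) g x.
Proof.
move=> ndK KO bg; rewrite -(Rintegral_interior d_gt0 ndK bg).
rewrite [LHS]Rintegral_mkcond [RHS]Rintegral_mkcond.
apply: eq_Rintegral => x _; rewrite !patchE indicE.
case: (boolP (x \in ((cell K)° : set 'rV[R]_d))); last by rewrite mul0r; case: ifP.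
by rewrite inE => /interior_subset/KO/mem_set ->; rewrite mul1r.
Qed.

(** This brings the particle number into the form in which the scheme tested with 1 speaks of it:
    closed cells and the product measure. Replacing interiors by closed cells costs nothing, first
    in [x] and then in [v]. *)
Lemma particle_numberE f : particle_number f =
  \sum_i \sum_j \int[(leb d \x leb d)%E]_(z in Kx i `*` Kv j) ev (f i j) z.1 z.2.
Proof.
pose h i j (z : 'rV[R]_d * 'rV[R]_d) : R :=
  \1_((Kx i)° `*` (Kv j)°) z * ev (f i j) z.1 z.2.
have bh i j : bmfun (Omega_x M `*` Omega_v M) (h i j).
  apply: bmfunM; last exact: bmfun_ev_prod.
  apply: bmfun_indic; apply: measurableX.
    by have [] := leb_cell_boundary d_gt0 (nondegenerate_x i).
  by have [] := leb_cell_boundary d_gt0 (nondegenerate_v j).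
have bhx i j : bmfun (Omega_x M) (fun x => \int[leb d]_(v in Omega_v M) h i j (x, v)).
  exact: (bmfun_Rintegral mOx mOv fOx fOv (bh i j)).
rewrite /particle_number.
transitivity (\int[leb d]_(x in Omega_x M)
    \sum_i \sum_j \int[leb d]_(v in Omega_v M) h i j (x, v)).
  apply: eq_Rintegral => x; rewrite inE => Ox.
  have ih i j := bmfun_integrable mOv fOv (bmfun_section mOx mOv Ox (bh i j)).
  rewrite /dgval Rintegral_sum// => [|i _]; last by apply: integrable_sumR => // j _; exact: ih.
  by apply: eq_bigr => i _; rewrite Rintegral_sum// => j _; exact: ih.
have ih i j := bmfun_integrable mOx fOx (bhx i j).
rewrite Rintegral_sum// => [|i _]; last by apply: integrable_sumR => // j _; exact: ih.
apply: eq_bigr => i _; rewrite Rintegral_sum//; apply: eq_bigr => j _.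
have bev : bmfun (Kx i `*` Kv j) (fun z => ev (f i j) z.1 z.2).
  by apply: bmfun_ev_prod => //; exact: cell_bounded.
(* The strip over all of [Omega_x] is used because the indicator of the interior in [x] is moved
   inside the integral over [Kv j] for every [x] of the domain, not only for those in [Kx i]. *)
have bev' : bmfun (Omega_x M `*` Kv j) (fun z => ev (f i j) z.1 z.2).
  by apply: bmfun_ev_prod => //; exact: cell_bounded.
rewrite -(bmfun_Fubini (mx i) (mv j))//.
rewrite -(Rintegral_indic_interior (nondegenerate_x i) (@cell_sub_x i)); last first.
  exact: (bmfun_Rintegral (mx i) (mv j) (fx i) (fv j) bev).
apply: eq_Rintegral => x; rewrite inE => Ox.
have bevx := bmfun_section mOx (mv j) Ox bev'.
rewrite -(RintegralZl _ (mv j)); last exact: (bmfun_integrable (mv j) (fv j) bevx).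
rewrite -(Rintegral_indic_interior (nondegenerate_v j) (@cell_sub_v j)); last first.
  by apply: bmfunM => //; exact: bmfun_cst.
apply: eq_Rintegral => v _; rewrite /h !indicE in_setX /=.
by case: (x \in _); case: (v \in _); rewrite ?mul1r ?mul0r ?mulr0.
Qed.

End DG_theory.

Section facets.
Context {R : realType} {d : nat}.

Lemma measurable_facet (K : element R d) F : (0 < d)%N -> Defs.nondegenerate K ->
  measurable (facet K F).
Proof.
move=> d0 nd; apply: measurableI; first exact: measurable_cell.
exact: measurable_hyperplane.
Qed.

Lemma facet_bounded (K : element R d) F : coor_bounded (facet K F).
Proof. by apply: coor_boundedS (cell_bounded K) => x []. Qed.

Lemma facet_hyperplane (K : element R d) F : facet K F `<=` [set x | dot F.1 x = F.2].
Proof. by move=> x []. Qed.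

Lemma periodN (per : 'M[R]_d) z : period per (- z) = - period per z.
Proof. by rewrite /period map_mxN mulNmx. Qed.

Lemma surface_integral_set0 F (h : 'rV[R]_d -> R) : surface_integral F set0 h = 0.
Proof.
rewrite /surface_integral (_ : [set _ | _] = set0) ?Rintegral_set0//.
by apply/seteqP; split=> x // [].
Qed.

Lemma eq_surface_integral F (A A' : set 'rV[R]_d) (h h' : 'rV[R]_d -> R) :
  A = A' -> h =1 h' -> surface_integral F A h = surface_integral F A' h'.
Proof. by move=> -> /funext ->. Qed.

Lemma translate0 (A : set 'rV[R]_d) : translate 0 A = A.
Proof. by apply/seteqP; split=> x; rewrite /translate /= subr0. Qed.

End facets.

(** * Face terms in x and in v, and their sums over the mesh *)

Section boundary.
Context {R : realType} {d : nat} (d_gt0 : (0 < d)%N) (M : phase_mesh R d).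
Implicit Types (f : dgfun M) (E : 'rV[R]_d -> 'rV[R]_d).

Local Notation Kx i := (cell (mesh_x M i)).
Local Notation Kv j := (cell (mesh_v M j)).

Let mx i : measurable (Kx i) := measurable_cell d_gt0 (@nondegenerate_x _ _ M i).
Let mv j : measurable (Kv j) := measurable_cell d_gt0 (@nondegenerate_v _ _ M j).
Let fx i : (leb d (Kx i) < +oo)%E := leb_bounded (mx i) (cell_bounded _).
Let fv j : (leb d (Kv j) < +oo)%E := leb_bounded (mv j) (cell_bounded _).
Let mfx i F := measurable_facet F d_gt0 (@nondegenerate_x _ _ M i).
Let mfv j F := measurable_facet F d_gt0 (@nondegenerate_v _ _ M j).

Definition dg1 : dgfun M := fun _ _ => 1.

Definition face_term (s : R) f j i F i' F' (v : 'rV[R]_d) (z : 'rV[int]_d) : R :=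
  surface_integral F
    (facet (mesh_x M i) F `&`
      translate (period (periods M) z) (facet (mesh_x M i') F'))
    (fun x => numerical_flux s v F.1 F'.1
                (ev (f i j) x v) (ev (f i' j) (x - period (periods M) z) v)).

Definition face_x (s : R) f j i F i' F' (v : 'rV[R]_d) : R :=
  \sum_(z \in [set: 'rV[int]_d]) face_term s f j i F i' F' v z.

(* Both sides are 0 if infinitely many terms are nonzero, so this does not
   depend on the finiteness of the sum over z. *)
Lemma face_xN s f j i F i' F' v : F'.1 == - F.1 ->
  face_x s f j i' F' i F v = - face_x s f j i F i' F' v.
Proof.
move=> /eqP FF'; rewrite /face_x.
have bijN : bijective (-%R : 'rV[int]_d -> 'rV[int]_d) by exists -%R; exact: opprK.
(* Seen from the other element, the neighbour lies at the opposite period. *)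
transitivity (\sum_(z \in [set: 'rV[int]_d]) face_term s f j i' F' i F v (- z)).
  exact: (@reindex_fsbigT R 0 _ _ _ -%R (face_term s f j i' F' i F v) bijN).
rewrite -[RHS]mulN1r mulr_fsumr; apply: eq_fsbigr => z _.
rewrite mulN1r /face_term periodN.
set S := _ `&` translate (period _ z) _.
have bS : coor_bounded S.
  by apply: coor_boundedS (facet_bounded (mesh_x M i) F); rewrite /S; exact: subIsetl.
apply: surface_integral_fluxN => //.
- exact: facet_bounded.
- exact: facet_hyperplane.
- exact: facet_hyperplane.
- apply: bmfun_ev => l; first exact: bmfun_hyperplane_proj.
  exact: bmfun_cst.
- apply: bmfun_ev => l; last exact: bmfun_cst.
  apply: (eq_bmfun (f := fun x =>
    hyperplane_proj F x ord0 l + (- period (periods M) z) ord0 l)).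
    by move=> x _; rewrite [RHS]mxE.
  by apply: bmfunD; [exact: bmfun_hyperplane_proj | exact: bmfun_cst].
Qed.

Lemma integrable_face_x s f j i F i' F' : F'.1 == - F.1 ->
  (leb d).-integrable (Kv j) (EFin \o face_x s f j i F i' F').
Proof.
move=> /eqP FF'.
have [per_unit _ _] := Omega_x_periodic M.
have finZ := finite_periods per_unit (@facet_bounded _ _ (mesh_x M i) F)
  (@facet_bounded _ _ (mesh_x M i') F').
set Z := [set z | _] in finZ.
(* The support of the sum over [z] may vary with [v]; the finite set [Z] contains it for all [v],
   which makes this a fixed finite sum of integrable functions. *)
have -> : face_x s f j i F i' F' = fun v =>
    \sum_(z <- finmap.enum_fset (fset_set Z)) face_term s f j i F i' F' v z.
  apply/funext => v; rewrite -fsbig_finite//; apply/esym/fsbig_widen => //.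
  move=> z [_ nZ]; rewrite /= /face_term (_ : _ `&` _ = set0) ?surface_integral_set0//.
  by apply: contrapT => /eqP/set0P.
apply: integrable_sumR => // z _.
rewrite /face_term FF'; set S := _ `&` _.
have mS : measurable S.
  by apply: measurableI; [exact: mfx | apply: measurable_translate; exact: mfx].
have bS : coor_bounded S.
  by apply: coor_boundedS (facet_bounded (mesh_x M i) F); rewrite /S; exact: subIsetl.
have mP := measurable_prism F mS.
apply: (@integrable_surface_flux R d (Kv j) s id F S
  (fun v x => ev (f i j) x v)
  (fun v x => ev (f i' j) (x - period (periods M) z) v)) => //.
- apply: bmfun_ev => l.
    by apply: (bmfun_snd (f := fun x : 'rV[R]_d => hyperplane_proj F x ord0 l)) => //;
      exact: bmfun_hyperplane_proj.
  apply: (bmfun_fst (f := fun v : 'rV[R]_d => v ord0 l)) => //.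
  by apply: bmfun_coor => //; exact: cell_bounded.
- apply: bmfun_ev => l.
    apply: (bmfun_snd (f := fun x : 'rV[R]_d =>
      (hyperplane_proj F x - period (periods M) z) ord0 l)) => //.
    apply: (eq_bmfun (f := fun x =>
    hyperplane_proj F x ord0 l + (- period (periods M) z) ord0 l)).
      by move=> x _; rewrite [RHS]mxE.
    by apply: bmfunD; [exact: bmfun_hyperplane_proj | exact: bmfun_cst].
  apply: (bmfun_fst (f := fun v : 'rV[R]_d => v ord0 l)) => //.
  by apply: bmfun_coor => //; exact: cell_bounded.
- apply: (bmfun_integrable (mv j) (fv j)); rewrite /dot; apply: bmfun_sum => l _.
  apply: bmfunM; last exact: bmfun_cst.
  by apply: bmfun_coor => //; exact: cell_bounded.
Qed.

Lemma ev1 (x v : 'rV[R]_d) : ev 1 x v = 1.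
Proof. exact: meval1. Qed.

Lemma sum_boundary_x s f j :
  \sum_i \int[leb d]_(v in Kv j) boundary_x s f dg1 i j v = 0.
Proof.
have E i : \int[leb d]_(v in Kv j) boundary_x s f dg1 i j v =
    \sum_(F <- facets (mesh_x M i)) \sum_i'
    \sum_(F' <- facets (mesh_x M i') | F'.1 == - F.1)
      \int[leb d]_(v in Kv j) face_x s f j i F i' F' v.
  transitivity (\int[leb d]_(v in Kv j) \sum_(F <- facets (mesh_x M i)) \sum_i'
    \sum_(F' <- facets (mesh_x M i') | F'.1 == - F.1) face_x s f j i F i' F' v).
    apply: eq_Rintegral => v _; apply: eq_bigr => F _; apply: eq_bigr => i' _.
    apply: eq_bigr => F' _; apply: eq_fsbigr => z _ /=.
    by apply: eq_surface_integral => // x; rewrite ev1 mulr1.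
  rewrite Rintegral_sum// => [|F _]; last first.
    apply: integrable_sumR => // i' _; apply: integrable_sumR => // F' FF'.
    exact: integrable_face_x.
  apply: eq_bigr => F _; rewrite Rintegral_sum// => [|i' _]; last first.
    by apply: integrable_sumR => // F' FF'; exact: integrable_face_x.
  apply: eq_bigr => i' _; rewrite Rintegral_sum// => F' FF'.
  exact: integrable_face_x.
under eq_bigr do rewrite E.
apply: (@sum_antisymmetric R _ ('rV[R]_d * R)%type _ _ (fun F F' => F'.1 == - F.1)
  (fun i F i' F' => \int[leb d]_(v in Kv j) face_x s f j i F i' F' v)).
  by move=> F F'; rewrite eq_sym eqr_oppLR.
move=> i F i' F' FF'; rewrite -mulN1r -RintegralZl//; last exact: integrable_face_x.
by apply: eq_Rintegral => v _; rewrite face_xN// mulN1r.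
Qed.

Definition face_v (s : R) f E i j F j' F' (x : 'rV[R]_d) : R :=
  surface_integral F (facet (mesh_v M j) F `&` facet (mesh_v M j') F')
    (fun v => numerical_flux s (E x) F.1 F'.1 (ev (f i j) x v) (ev (f i j') x v)).

(** The case $p=0$ of [surface_integral_fluxN], since nothing is identified periodically in the
    velocity. *)
Lemma face_vN s f E i j F j' F' x : F'.1 == - F.1 ->
  face_v s f E i j' F' j F x = - face_v s f E i j F j' F' x.
Proof.
move=> /eqP FF'.
pose P v := ev (f i j) x v; pose Q v := ev (f i j') x v.
set A := facet (mesh_v M j) F; set A' := facet (mesh_v M j') F'.
have bS : coor_bounded (A `&` translate 0 A').
  by apply: coor_boundedS (facet_bounded (mesh_v M j) F); exact: subIsetl.
transitivity (surface_integral F' (A' `&` translate (- 0) A)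
  (fun y => numerical_flux s (E x) F'.1 F.1 (Q y) (P (y - - 0)))).
  apply: eq_surface_integral => [|y]; last by rewrite oppr0 subr0.
  by rewrite oppr0 translate0.
have bev g : bmfun (prism F (A `&` translate 0 A'))
    (fun v => ev g x (hyperplane_proj F v)).
  by apply: bmfun_ev => l; [exact: bmfun_cst | exact: bmfun_hyperplane_proj].
have bQ : bmfun (prism F (A `&` translate 0 A')) (fun v => Q (hyperplane_proj F v - 0)).
  by under eq_fun do rewrite subr0; exact: bev.
have bA : coor_bounded A by exact: facet_bounded.
have AF : A `<=` [set y | dot F.1 y = F.2] by exact: facet_hyperplane.
have AF' : A' `<=` [set y | dot F'.1 y = F'.2] by exact: facet_hyperplane.
apply: etrans (surface_integral_fluxN s (E x) FF' (mfv j F) (mfv j' F')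
  bA AF AF' (bev _) bQ) _.
apply: (congr1 -%R); apply: eq_surface_integral => [|y]; last by rewrite subr0.
exact: (congr1 (fun B => A `&` B) (translate0 A')).
Qed.

Lemma integrable_face_v s f E i j F j' F' : F'.1 == - F.1 ->
  (leb d).-integrable (Kx i) (EFin \o (fun x => dot (E x) F.1)) ->
  (leb d).-integrable (Kx i) (EFin \o face_v s f E i j F j' F').
Proof.
move=> /eqP FF' iE; rewrite /face_v FF'; set S := _ `&` _.
have mS : measurable S by apply: measurableI; exact: mfv.
have bS : coor_bounded S.
  by apply: coor_boundedS (facet_bounded (mesh_v M j) F); rewrite /S; exact: subIsetl.
have mP := measurable_prism F mS.
apply: (@integrable_surface_flux R d (Kx i) s E F S
  (fun x v => ev (f i j) x v) (fun x v => ev (f i j') x v)) => //.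
- apply: bmfun_ev => l; last first.
    by apply: (bmfun_snd (f := fun x : 'rV[R]_d => hyperplane_proj F x ord0 l)) => //;
      exact: bmfun_hyperplane_proj.
  apply: (bmfun_fst (f := fun v : 'rV[R]_d => v ord0 l)) => //.
  by apply: bmfun_coor => //; exact: cell_bounded.
- apply: bmfun_ev => l; last first.
    by apply: (bmfun_snd (f := fun x : 'rV[R]_d => hyperplane_proj F x ord0 l)) => //;
      exact: bmfun_hyperplane_proj.
  apply: (bmfun_fst (f := fun v : 'rV[R]_d => v ord0 l)) => //.
  by apply: bmfun_coor => //; exact: cell_bounded.
Qed.

(** Both the inner trace and the exterior value are 0, so both terms of [numerical_fluxE] vanish and
    the integrand is 0 at every point of the domain. *)
Lemma frontier_flux0 s f E g i j F x : vanishes_on_frontier f -> Kx i x ->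
  surface_integral F (facet (mesh_v M j) F `&` frontier (Omega_v M))
    (fun v => numerical_flux s (E x) F.1 (- F.1) (ev (f i j) x v) 0 * ev (g i j) x v) = 0.
Proof.
move=> f0 Kxx; rewrite /surface_integral /Rintegral integral0_eq// => v /= [_ [[Kvv _] Ov]].
by rewrite (f0 _ _ _ _ Kxx Kvv Ov) numerical_fluxE addr0 subr0 !mulr0 addr0 mul0r.
Qed.

Lemma sum_boundary_v s f E i : vanishes_on_frontier f ->
  (forall n, (leb d).-integrable (Kx i) (EFin \o (fun x => dot (E x) n))) ->
  \sum_j \int[leb d]_(x in Kx i) boundary_v s f E dg1 i j x = 0.
Proof.
move=> f0 iE.
have H j : \int[leb d]_(x in Kx i) boundary_v s f E dg1 i j x =
    \sum_(F <- facets (mesh_v M j)) \sum_j'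
    \sum_(F' <- facets (mesh_v M j') | F'.1 == - F.1)
      \int[leb d]_(x in Kx i) face_v s f E i j F j' F' x.
  transitivity (\int[leb d]_(x in Kx i) \sum_(F <- facets (mesh_v M j)) \sum_j'
    \sum_(F' <- facets (mesh_v M j') | F'.1 == - F.1) face_v s f E i j F j' F' x).
    apply: eq_Rintegral => x; rewrite inE => Kxx; apply: eq_bigr => F _.
    rewrite frontier_flux0// addr0; apply: eq_bigr => j' _.
    apply: eq_bigr => F' _.
    by apply: eq_surface_integral => // v; rewrite ev1 mulr1.
  rewrite Rintegral_sum// => [|F _]; last first.
    apply: integrable_sumR => // i' _; apply: integrable_sumR => // F' FF'.
    exact: integrable_face_v.
  apply: eq_bigr => F _; rewrite Rintegral_sum// => [|i' _]; last first.
    by apply: integrable_sumR => // F' FF'; exact: integrable_face_v.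
  apply: eq_bigr => i' _; rewrite Rintegral_sum// => F' FF'.
  exact: integrable_face_v.
under eq_bigr do rewrite H.
apply: (@sum_antisymmetric R _ ('rV[R]_d * R)%type _ _ (fun F F' => F'.1 == - F.1)
  (fun j F j' F' => \int[leb d]_(x in Kx i) face_v s f E i j F j' F' x)).
  by move=> F F'; rewrite eq_sym eqr_oppLR.
move=> j F j' F' FF'; rewrite -mulN1r -RintegralZl//; last exact: integrable_face_v.
by apply: eq_Rintegral => x _; rewrite face_vN// mulN1r.
Qed.

End boundary.

(** * Time steps *)

Section conservation.
Context {R : realType} {d : nat} (d_gt0 : (0 < d)%N) (M : phase_mesh R d).
Context (k : nat) (phi : flux).
Implicit Types (f : dgfun M) (E : 'rV[R]_d -> 'rV[R]_d).

Local Notation Kx i := (cell (mesh_x M i)).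
Local Notation Kv j := (cell (mesh_v M j)).

Let mx i : measurable (Kx i) := measurable_cell d_gt0 (@nondegenerate_x _ _ M i).
Let mv j : measurable (Kv j) := measurable_cell d_gt0 (@nondegenerate_v _ _ M j).
Let fx i : (leb d (Kx i) < +oo)%E := leb_bounded (mx i) (cell_bounded _).
Let fv j : (leb d (Kv j) < +oo)%E := leb_bounded (mv j) (cell_bounded _).
Let mOx := partition_measurable d_gt0 (mesh_x_partition M).

Lemma B_dg1 s f E i j : B s f E (@dg1 _ _ M) i j =
  \int[leb d]_(v in Kv j) boundary_x s f (@dg1 _ _ M) i j v
  + \int[leb d]_(x in Kx i) boundary_v s f E (@dg1 _ _ M) i j x.
Proof.
have ev_mderiv1 (l : 'I_(d + d)) (x v : 'rV[R]_d) : ev (mderiv l 1) x v = 0.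
  by rewrite -mpolyC1 mderivC; exact: meval0.
have int0 (h g : 'rV[R]_d * 'rV[R]_d -> 'rV[R]_d) (a : 'rV[R]_d * 'rV[R]_d -> R) :
    (forall z, g z = 0) ->
    \int[(leb d \x leb d)%E]_(z in Kx i `*` Kv j) (a z * dot (h z) (g z)) = 0.
  move=> g0; rewrite /Rintegral integral0_eq// => z _.
  by rewrite g0 /dot big1 ?mulr0// => l _; rewrite mxE mulr0.
rewrite /B !int0 ?oppr0 ?subr0 ?add0r//.
  by move=> z; apply/rowP => l; rewrite !mxE ev_mderiv1.
by move=> z; apply/rowP => l; rewrite !mxE ev_mderiv1.
Qed.

(** The step shared by all schemes, which differ only in the choice of [fm], [E] and [tau]; the sign
    of [tau] is left open. *)
Lemma vlasov_particle_number tau f f' fm E : tau != 0 ->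
  vlasov_eq k phi tau f f' fm E -> vanishes_on_frontier fm ->
  integrable_field M E -> particle_number f' = particle_number f.
Proof.
move=> tau0 vlasov fm0 iE.
have iEn i n : (leb d).-integrable (Kx i) (EFin \o (fun x => dot (E x) n)).
  apply: (integrableS mOx (mx i) (@cell_sub_x _ _ M i)).
  rewrite /dot; apply: integrable_sumR => // l _.
  under eq_fun do rewrite mulrC.
  apply: integrable_bmfunM => //; [exact: bmfun_cst | exact: iE].
pose I f i j := \int[(leb d \x leb d)%E]_(z in Kx i `*` Kv j) ev (f i j) z.1 z.2.
have mass i j : (I f' i j - I f i j) / tau +
    B (jump_sign phi tau) fm E (@dg1 _ _ M) i j = 0.
  (* The constant 1 has [msize] 1, so it is an admissible test function for every [k], including
     0. *)
  rewrite -(vlasov (@dg1 _ _ M) i j); last by move=> ? ?; rewrite msize1.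
  congr (_ + _).
  have mK := measurableX (mx i) (mv j).
  have iev g : (leb d \x leb d)%E.-integrable (Kx i `*` Kv j)
      (EFin \o (fun z => ev g z.1 z.2)).
    apply: bmfun_integrable => //; first exact: product_finite.
    by apply: bmfun_ev_prod => //; exact: cell_bounded.
  rewrite /I -RintegralB// -RintegralZr//; last first.
    have := integrableB mK (iev (f' i j)) (iev (f i j)).
    by [].
  by apply: eq_Rintegral => z _; rewrite ev1 mulr1.
rewrite !(particle_numberE d_gt0); apply/eqP; rewrite -subr_eq0 -sumrB.
suff : (\sum_i (\sum_j I f' i j - \sum_j I f i j)) / tau = 0.
  by move=> /eqP; rewrite mulf_eq0 invr_eq0 (negbTE tau0) orbF.
transitivity (- \sum_i \sum_j B (jump_sign phi tau) fm E (@dg1 _ _ M) i j).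
  rewrite mulr_suml -sumrN; apply: eq_bigr => i _.
  rewrite -sumrB mulr_suml -sumrN; apply: eq_bigr => j _.
  by apply/eqP; rewrite -addr_eq0; apply/eqP.
(* Fluxes in [x] cancel in the sum over [i] for each [j], fluxes in [v] in the sum over [j] for each
   [i]; hence only the first part has its sums exchanged. *)
under eq_bigr do (under eq_bigr do rewrite B_dg1; rewrite big_split /=).
rewrite big_split /= exchange_big big1 ?add0r => [|j _].
  by rewrite big1 ?oppr0// => i _; exact: sum_boundary_v.
exact: sum_boundary_x.
Qed.

(** Solved for the new field, the equation is $E'=E-\tau J$ on [Omega_x]. This is valid for implicit
    schemes too, as the current of any discrete function is integrable. *)
Lemma integrable_ampere tau E E' J : tau != 0 -> ampere_eq M tau E E' J ->
  integrable_field M J -> integrable_field M E -> integrable_field M E'.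
Proof.
move=> tau0 amp iJ iE l.
apply: (eq_integrable mOx (EFin \o (fun x => E x ord0 l + - tau * J x ord0 l))).
  move=> x; rewrite inE => Ox /=; congr (_%:E).
  have /(congr1 (fun u => - tau *: u)) := amp x Ox.
  rewrite scalerA mulNr mulfV// scaleN1r scalerN scaleNr opprK opprB => /rowP/(_ l).
  rewrite !mxE => e; rewrite mulNr -e; ring.
have := integrableD mOx (iE l)
  (integrable_bmfunM mOx (bmfun_cst (Omega_x M) (- tau)) (iJ l)).
by [].
Qed.

Lemma integrable_average_field E E' : integrable_field M E -> integrable_field M E' ->
  integrable_field M (average_field E E').
Proof.
move=> iE iE' l; apply: (eq_integrable mOx
    (EFin \o (fun x => 2^-1 * (E x ord0 l + E' x ord0 l)))).
  by move=> x _; rewrite /= !mxE.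
apply: integrable_bmfunM => //; first exact: bmfun_cst.
have := integrableD mOx (iE l) (iE' l).
by [].
Qed.

Lemma vanishes_average f f' : vanishes_on_frontier f -> vanishes_on_frontier f' ->
  vanishes_on_frontier (average f f').
Proof.
move=> h h' i j x v Kxx Kvv Ov; rewrite /average /ev mevalZ mevalD.
by rewrite -/(ev _ _ _) -/(ev (f' i j) _ _) h// h'// addr0 mulr0.
Qed.

(** Integrability of the field is carried along so that steps can be chained, and [tau] is merely
    nonzero because the middle substep of the fourth-order compositions runs backwards. *)
Definition conservative (S : step M) : Prop := forall tau st st',
  tau != 0 -> integrable_field M st.2 -> S tau st st' ->
  integrable_field M st'.2 /\ particle_number st'.1 = particle_number st.1.

Lemma conservative1 : conservative (@step1 _ _ M k phi).
Proof.
move=> tau [f E] [f' E'] tau0 iE [fh [[_ [_ fh0] _] _ amp vlasov]] /=.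
have iE' := integrable_ampere tau0 amp (integrable_current d_gt0 fh) iE.
split; first exact: iE'.
exact: (vlasov_particle_number tau0 vlasov fh0 (integrable_average_field iE iE')).
Qed.

Lemma conservative2 : conservative (@step2 _ _ M k phi).
Proof.
move=> tau [f E] [f' E'] tau0 iE [[[_ f0] [_ f'0]] vlasov amp] /=.
have iJ := integrable_average_field
  (integrable_current d_gt0 f) (integrable_current d_gt0 f').
have iE' := integrable_ampere tau0 amp iJ iE.
split; first exact: iE'.
exact: (vlasov_particle_number tau0 vlasov (vanishes_average f0 f'0)
  (integrable_average_field iE iE')).
Qed.

Lemma conservative3 : conservative (@step3 _ _ M k phi).
Proof.
move=> tau [f E] [f' E'] tau0 iE [Eh [[[_ f0] [_ f'0]] amp vlasov amp']] /=.
have tau20 : tau / 2 != 0 by rewrite mulf_neq0// invr_eq0 pnatr_eq0.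
have iEh := integrable_ampere tau20 amp (integrable_current d_gt0 f) iE.
have iE' := integrable_ampere tau20 amp' (integrable_current d_gt0 f') iEh.
split; first exact: iE'.
exact: (vlasov_particle_number tau0 vlasov (vanishes_average f0 f'0) iEh).
Qed.

(** The two powers of 2 are nonnegative, so [beta1] is at least $2/3$. The threshold $1/2$ is the
    one that makes [beta2] negative, so that no substep has length 0. *)
Lemma beta1_gt_half : 2^-1 < beta1 :> R.
Proof.
rewrite /beta1; have := powR_ge0 (2 : R) 3^-1; have := powR_ge0 (2 : R) (- 3^-1).
lra.
Qed.

Lemma conservative_fourth_order (S : step M) :
  conservative S -> conservative (fourth_order S).
Proof.
move=> cS tau st st' tau0 iE [st1 [st2 [S1 S2 S3]]].
have b1 := beta1_gt_half.
have b10 : beta1 * tau != 0 by rewrite mulf_neq0// gt_eqF// (lt_trans _ b1).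
have b20 : beta2 * tau != 0 by rewrite mulf_neq0// lt_eqF// /beta2; lra.
(* [beta3] unfolds to [beta1], so [b10] serves the first and the last substep. *)
have [iE1 e1] := cS _ _ _ b10 iE S1.
have [iE2 e2] := cS _ _ _ b20 iE1 S2.
have [iE3 e3] := cS _ _ _ b10 iE2 S3.
refine (conj iE3 _).
exact: (etrans e3 (etrans e2 e1)).
Qed.

Lemma conservative_scheme X : conservative (@scheme_step _ _ M k phi X).
Proof.
case: X; [exact: conservative1 | exact: conservative2 | exact: conservative3 | |].
  exact/conservative_fourth_order/conservative2.
exact/conservative_fourth_order/conservative3.
Qed.

End conservation.

Theorem theorem3p4 (R : realType) (d : nat) (d_gt0 : (0 < d)%N)
    (M : phase_mesh R d) (k : nat) (phi : flux) (X : scheme)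
    (dt : R) (dt_gt0 : 0 < dt)
    (f : nat -> dgfun M) (E : nat -> 'rV[R]_d -> 'rV[R]_d)
    (E0_integrable : integrable_field M (E 0%N))
    (solution : forall n,
      scheme_step k phi X dt (f n, E n) (f n.+1, E n.+1)) :
  forall n, particle_number (f n.+1) = particle_number (f n).
Proof.
have dt0 : dt != 0 by rewrite gt_eqF.
(* Only the initial field is assumed integrable; each step passes integrability on to the next
   field. *)
have iE n : integrable_field M (E n).
  elim: n => // n iE.
  exact: (conservative_scheme d_gt0 (st := (f n, E n))
    (st' := (f n.+1, E n.+1)) dt0 iE (solution n)).1.
move=> n.
exact: (conservative_scheme d_gt0 (st := (f n, E n))
  (st' := (f n.+1, E n.+1)) dt0 (iE n) (solution n)).2.
Qed.
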